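(* Let $d$ be a sufficiently large integer, let $\epsilon=\exp(-\log^5 d)$ and let $\delta\in(0,1)$ be a constant. Consider any randomized first-order algorithm that, for every $1$-Lipschitz convex function $F:\mathbb{B}^d\to\mathbb{R}$, finds an $\epsilon$-optimal point with probability at least $2/3$. Then either it uses $\Omega(d^{2-\delta})$ bits of memory, or it makes $\Omega(d^{1+\delta/6-o(1)})$ queries.
   Context: $\mathbb{B}^d$ is the closed unit Euclidean ball in $\mathbb{R}^d$. Model of memory-constrained first-order optimization: an $S$-bit, $T$-query deterministic algorithm has oracle access to a $1$-Lipschitz convex $F:\mathbb{B}^d\to\mathbb{R}$. It starts with a memory state $\mathbf{M}_0\in\{0,1\}^S$; in iteration $t\in[T]$ it chooses a query $\mathbf{x}_t\in\mathbb{B}^d$ as a function of $\mathbf{M}_{t-1}$, receives $F(\mathbf{x}_t)$ and a subgradient $\mathbf{g}(\mathbf{x}_t)\in\partial F(\mathbf{x}_t)$, and updates its memory to $\mathbf{M}_t\in\{0,1\}^S$ as a function of $\mathbf{M}_{t-1},F(\mathbf{x}_t),\mathbf{g}(\mathbf{x}_t)$; after $T$ iterations it outputs a point $\mathbf{x}_T\in\mathbb{B}^d$ as a function of $\mathbf{M}_{T-1}$. A randomized algorithm is a probability distribution over deterministic algorithms. A point $\mathbf{x}$ is $\epsilon$-optimal if $F(\mathbf{x})-\min_{\mathbf{y}\in\mathbb{B}^d}F(\mathbf{y})\le\epsilon$. *)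

(* Defs.v *)
From HB Require Import structures.
From mathcomp Require Import all_boot all_order all_algebra.
From mathcomp Require Import all_classical all_reals all_analysis.
Set Implicit Arguments. Unset Strict Implicit. Unset Printing Implicit Defensive.
Import Order.TTheory GRing.Theory Num.Theory.
Import numFieldNormedType.Exports.
Local Open Scope ring_scope.

Section MemOpt.
Variables (R : realType) (d : nat).

Definition dotv (u v : 'rV[R]_d) : R := \sum_(i < d) u 0 i * v 0 i.
Definition normv (u : 'rV[R]_d) : R := Num.sqrt (dotv u u).

Definition in_ball (x : 'rV[R]_d) : Prop := normv x <= 1.

Definition lipschitz1_ball (F : 'rV[R]_d -> R) : Prop :=
  forall x y, in_ball x -> in_ball y -> `|F x - F y| <= normv (x - y).

Definition convex_ball (F : 'rV[R]_d -> R) : Prop :=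
  forall x y (l : R), in_ball x -> in_ball y -> 0 <= l -> l <= 1 ->
    F (l *: x + (1 - l) *: y) <= l * F x + (1 - l) * F y.

Definition is_subgradient_oracle (F : 'rV[R]_d -> R) (g : 'rV[R]_d -> 'rV[R]_d)
  : Prop :=
  forall x, in_ball x -> forall y, in_ball y -> F x + dotv (g x) (y - x) <= F y.

Definition eps_optimal (F : 'rV[R]_d -> R) (eps : R) (x : 'rV[R]_d) : Prop :=
  in_ball x /\ forall y, in_ball y -> F x - F y <= eps.

Record det_alg (S : nat) := DetAlg {
  mem0 : {ffun 'I_S -> bool};
  query : {ffun 'I_S -> bool} -> 'rV[R]_d;
  update : {ffun 'I_S -> bool} -> R -> 'rV[R]_d -> {ffun 'I_S -> bool};
  output : {ffun 'I_S -> bool} -> 'rV[R]_d;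
  query_in_ball : forall M, in_ball (query M);
  output_in_ball : forall M, in_ball (output M)
}.

Definition alg_step (S : nat) (A : det_alg S) (F : 'rV[R]_d -> R)
  (g : 'rV[R]_d -> 'rV[R]_d) (M : {ffun 'I_S -> bool}) : {ffun 'I_S -> bool} :=
  update A M (F (query A M)) (g (query A M)).

Definition alg_mem (S : nat) (A : det_alg S) F g (t : nat) : {ffun 'I_S -> bool} :=
  iter t (alg_step A F g) (mem0 A).

(* Output of a T-query algorithm: a function of M_{T-1}. *)
Definition alg_out (S T : nat) (A : det_alg S) F g : 'rV[R]_d :=
  output A (alg_mem A F g T.-1).

End MemOpt.

(* Main.v *)
(** A hard instance is the maximum, suitably scaled, of the walls
    [Lam * |<a_j, x>| - 1] and of the Nemirovski pieces
    [<v_i, x> / sqrt d - i * gam], with random sign vectors [a_j] (j < n) and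
    [v_i] (i < N). Some vector orthogonal to all [a_j] has
    [<v_i, x> / sqrt d <= - N * gam] for every [i], and an approximate minimizer
    can only be found after the oracle has revealed [v_0, ..., v_(N-1)] one
    after the other: the first query that reveals a vector beyond [v_i] is
    correlated with [v_i] and nearly orthogonal to all [a_j]. If T < N * n / 16
    then some phase, between two revelations, consists of fewer than n / 16
    queries, so that the memory state at the beginning of the phase together
    with the few rows [a_j] queried in it suffices to produce such a query for
    a fresh random [v_i].

    This is a game that needs much memory. Fix a set of [u] rows hidden from
    the oracle during the phase. Playing against [K] fresh vectors [v] from the
    same memory state yields [K] points, each far from the span of the previous
    ones, that are all nearly orthogonal to the [u] hidden rows. By Cramer's
    rule on a well-conditioned minor this determines [K / 2] signs of each of
    these rows; counting the pairs of a matrix and a winning [K]-tuple gives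
    2^(K u / 2) <= 2^S * d^(O(K)), where [K] and [u] may be taken of order
    d / N^3 up to logarithms. With N = d^(delta/6 - o(1)) this is
    S >= d^(2 - delta). *)
Require Import Defs.
From HB Require Import structures.
From mathcomp Require Import all_boot all_order all_algebra.
From mathcomp Require Import all_classical all_reals all_analysis.
From mathcomp Require Import measurable_realfun.
From mathcomp Require Import ring lra zify.
Set Implicit Arguments. Unset Strict Implicit. Unset Printing Implicit Defensive.
Import Order.TTheory GRing.Theory Num.Theory.
Import numFieldNormedType.Exports.
Local Open Scope classical_set_scope.
Local Open Scope ring_scope.

(** * Inner products and random sign vectors *)

Section InnerProduct.
Variables (R : realType) (d : nat).
Implicit Types u v w p : 'rV[R]_d.

Lemma dotvC u v : dotv u v = dotv v u.
Proof. by apply: eq_bigr => i _; rewrite mulrC. Qed.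

Lemma dotvDl u v w : dotv (u + v) w = dotv u w + dotv v w.
Proof. by rewrite /dotv -big_split; apply: eq_bigr => i _; rewrite mxE mulrDl. Qed.

Lemma dotvZl (c : R) u v : dotv (c *: u) v = c * dotv u v.
Proof. by rewrite /dotv mulr_sumr; apply: eq_bigr => i _; rewrite mxE mulrA. Qed.

Lemma dotvDr u v w : dotv w (u + v) = dotv w u + dotv w v.
Proof. by rewrite dotvC dotvDl !(dotvC w). Qed.

Lemma dotvZr (c : R) u v : dotv u (c *: v) = c * dotv u v.
Proof. by rewrite dotvC dotvZl dotvC. Qed.

Lemma dotvNl u v : dotv (- u) v = - dotv u v.
Proof. by rewrite -scaleN1r dotvZl mulN1r. Qed.

Lemma dotvNr u v : dotv u (- v) = - dotv u v.
Proof. by rewrite dotvC dotvNl dotvC. Qed.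

Lemma dotvBl u v w : dotv (u - v) w = dotv u w - dotv v w.
Proof. by rewrite dotvDl dotvNl. Qed.

Lemma dotvBr u v w : dotv w (u - v) = dotv w u - dotv w v.
Proof. by rewrite dotvDr dotvNr. Qed.

Lemma dotv0l u : dotv 0 u = 0.
Proof. by rewrite /dotv big1 // => i _; rewrite mxE mul0r. Qed.

Lemma dotv0r u : dotv u 0 = 0.
Proof. by rewrite dotvC dotv0l. Qed.

Lemma dotv_suml (I : Type) (r : seq I) (P : pred I) (F : I -> 'rV[R]_d) v :
  dotv (\sum_(i <- r | P i) F i) v = \sum_(i <- r | P i) dotv (F i) v.
Proof.
by elim/big_rec2 : _ => [|i x y _ <-]; rewrite ?dotv0l // dotvDl.
Qed.

Lemma dotv_sumr (I : Type) (r : seq I) (P : pred I) (F : I -> 'rV[R]_d) v :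
  dotv v (\sum_(i <- r | P i) F i) = \sum_(i <- r | P i) dotv v (F i).
Proof. by rewrite dotvC dotv_suml; apply: eq_bigr => i _; rewrite dotvC. Qed.

Lemma dotvv_ge0 u : 0 <= dotv u u.
Proof. by apply: sumr_ge0 => i _; rewrite -expr2 sqr_ge0. Qed.

Lemma dotvv_eq0 u : dotv u u = 0 -> u = 0.
Proof.
move=> h; apply/rowP => j; rewrite mxE; apply/eqP; rewrite -sqrf_eq0 expr2.
have := @psumr_eq0P R 'I_d xpredT (fun i => u 0 i * u 0 i).
by move=> /(_ _ h) -> // i _; rewrite -expr2 sqr_ge0.
Qed.

Lemma dotv_CS u v : dotv u v ^+ 2 <= dotv u u * dotv v v.
Proof.
have [/dotvv_eq0 ->|nz] := eqVneq (dotv v v) 0.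
  by rewrite !dotv0r expr0n mulr0.
have vpos : 0 < dotv v v by rewrite lt_def nz dotvv_ge0.
have := dotvv_ge0 (dotv v v *: u - dotv u v *: v).
rewrite !(dotvBl, dotvBr, dotvZl, dotvZr) (dotvC v u) => h.
rewrite -subr_ge0 -(pmulr_rge0 _ vpos); apply: le_trans h _.
by rewrite le_eqVlt; apply/orP; left; apply/eqP; ring.
Qed.

Lemma normv_ge0 u : 0 <= normv u. Proof. exact: sqrtr_ge0. Qed.

Lemma sqr_normv u : normv u ^+ 2 = dotv u u.
Proof. by rewrite sqr_sqrtr ?dotvv_ge0. Qed.

Lemma normv_le (b : R) u : 0 <= b -> (normv u <= b) = (dotv u u <= b ^+ 2).
Proof. by move=> b0; rewrite -sqr_normv ler_sqr ?nnegrE ?normv_ge0. Qed.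

Lemma ler_dotv u v : `|dotv u v| <= normv u * normv v.
Proof.
rewrite -(@ler_sqr R) ?nnegrE ?mulr_ge0 ?normv_ge0 //.
by rewrite real_normK ?num_real // exprMn !sqr_normv dotv_CS.
Qed.

Lemma normvD u v : normv (u + v) <= normv u + normv v.
Proof.
rewrite normv_le ?addr_ge0 ?normv_ge0 // sqrrD !sqr_normv.
rewrite dotvDl !dotvDr (dotvC v u).
have := ler_dotv u v; have := ler_norm (dotv u v); lra.
Qed.

Lemma normvN u : normv (- u) = normv u.
Proof. by rewrite /normv dotvNl dotvNr opprK. Qed.

Lemma normvZ (c : R) u : normv (c *: u) = `|c| * normv u.
Proof.
rewrite /normv dotvZl dotvZr mulrA -expr2 sqrtrM ?sqr_ge0 //.
by rewrite sqrtr_sqr.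
Qed.

Lemma ler_coord_normv u j : `|u 0 j| <= normv u.
Proof.
rewrite -(@ler_sqr R) ?nnegrE ?normv_ge0 // real_normK ?num_real // sqr_normv.
rewrite /dotv (bigD1 j) //= -expr2 lerDl; apply: sumr_ge0 => i _.
by rewrite -expr2 sqr_ge0.
Qed.

Lemma ex_large_coord (rho : R) u : (0 < d)%N -> 0 <= rho -> rho <= normv u ->
  exists j, rho / Num.sqrt d%:R <= `|u 0 j|.
Proof.
move=> d0 rho0 hu; apply: contrapT => /forallNP h.
have d0R : 0 < (d%:R : R) by rewrite ltr0n.
have {}h j : `|u 0 j| < rho / Num.sqrt d%:R by rewrite ltNge; apply/negP/h.
suff : dotv u u < rho ^+ 2.
  by rewrite -sqr_normv ltNge ler_sqr ?nnegrE ?normv_ge0 ?hu.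
have -> : rho ^+ 2 = \sum_(j < d) (rho / Num.sqrt d%:R) ^+ 2.
  rewrite sumr_const card_ord exprMn exprVn sqr_sqrtr ?ler0n //.
  by rewrite -[RHS]mulr_natr divfK // gt_eqF.
apply: ltr_sum; first by apply/hasP; exists (Ordinal d0); rewrite ?mem_index_enum.
move=> j _; rewrite -expr2 -real_normK ?num_real //.
by rewrite ltr_sqr ?nnegrE ?normr_ge0 // divr_ge0 // sqrtr_ge0.
Qed.

End InnerProduct.

Notation signs d := {ffun 'I_d -> bool}.

Section SignVectors.
Variables (R : realType) (d : nat).

Definition vec (a : signs d) : 'rV[R]_d := \row_j (-1) ^+ a j.

Lemma dotv_vec a : dotv (vec a) (vec a) = d%:R.
Proof.
rewrite /dotv -[d in RHS](card_ord d) -sumr_const; apply: eq_bigr => j _.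
by rewrite !mxE -expr2 sqrr_sign.
Qed.

Lemma normv_vec a : normv (vec a) = Num.sqrt d%:R.
Proof. by rewrite /normv dotv_vec. Qed.

Lemma card_signs : #|{: signs d}| = (2 ^ d)%N.
Proof. by rewrite card_ffun card_bool card_ord. Qed.

(** Weaker than the sharp exponent [x ^+ 2 / 2] but elementary: for [x > 1/2] the exponents already
    compare, and for small [x] the tangent bounds at [x] and [- x] suffice, as the two exponentials
    have product 1. *)
Lemma ler_cosh (x : R) : expR x + expR (- x) <= 2 * expR (2 * x ^+ 2).
Proof.
wlog x0 : x / 0 <= x.
  move=> h; case: (leP 0 x) => [x0|/ltW x0]; first exact: h.
  rewrite addrC.
  by have := h (- x); rewrite opprK sqrrN; apply; rewrite oppr_ge0.
have pos := expR_gt0 x; have posN := expR_gt0 (- x).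
case: (leP x (1 / 2)) => hx.
  have h1 : 1 - x <= expR (- x) by exact: expR_ge1Dx.
  have h2 : 1 + x <= expR x by exact: expR_ge1Dx.
  have h3 : 1 + 2 * x ^+ 2 <= expR (2 * x ^+ 2) by exact: expR_ge1Dx.
  have e : expR x * expR (- x) = 1 by rewrite -expRD subrr expR0.
  set y := expR x in h2 e pos *; set z := expR (- x) in h1 e posN *.
  have : y + z <= 2 * (1 + 2 * x ^+ 2) by nra.
  lra.
have h1 : expR (- x) <= expR x by rewrite ler_expR; lra.
have h2 : expR x <= expR (2 * x ^+ 2) by rewrite ler_expR; nra.
lra.
Qed.

(** Markov's inequality in counting form. *)
Lemma natr_card_ler_sum (T : finType) (P : pred T) (f : T -> R) :
  (forall x, 0 <= f x) -> (forall x, P x -> 1 <= f x) ->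
  #|P|%:R <= \sum_x f x.
Proof.
move=> f0 f1; rewrite -sum1_card natr_sum big_mkcond /=.
by apply: ler_sum => x _; case: ifP => // Px; apply: f1.
Qed.

(** Chernoff's method: the exponential moment factors over the coordinates and [ler_cosh] bounds
    each factor. The choice [lam = s / (4 * b)] minimizes [2 * lam ^+ 2 * b - lam * s]. *)
Lemma sign_tail (p : 'rV[R]_d) (b s : R) : 0 < b -> dotv p p <= b -> 0 <= s ->
  #|[pred a : signs d | s <= dotv (vec a) p]|%:R
    <= 2 ^+ d * expR (- (s ^+ 2 / (8 * b))).
Proof.
move=> b0 pb s0.
pose lam := s / (4 * b).
apply: (le_trans (natr_card_ler_sum
    (f := fun a => expR (lam * (dotv (vec a) p - s))) _ _)).
- by move=> a; exact: expR_ge0.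
- move=> a /= ha; rewrite -[1]expR0 ler_expR mulr_ge0 ?subr_ge0 //.
  by rewrite divr_ge0 // mulr_ge0 // ltW.
have -> : \sum_(a : signs d) expR (lam * (dotv (vec a) p - s)) =
  expR (- (lam * s)) * \prod_(j < d) (expR (lam * p 0 j) + expR (- (lam * p 0 j))).
  transitivity (expR (- (lam * s)) * \prod_(j < d) \sum_(e : bool)
      expR (lam * ((-1) ^+ e * p 0 j))).
    rewrite bigA_distr_bigA /= mulr_sumr; apply: eq_bigr => a _.
    rewrite mulrBr addrC expRD; congr (_ * _).
    rewrite /dotv mulr_sumr expR_sum; apply: eq_bigr => j _.
    by rewrite mxE.
  congr (_ * _); apply: eq_bigr => j _; rewrite big_bool /= addrC.
  by rewrite expr0 expr1 mul1r mulN1r mulrN.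
have le1 : \prod_(j < d) (expR (lam * p 0 j) + expR (- (lam * p 0 j))) <=
    2 ^+ d * expR (2 * lam ^+ 2 * b).
  apply: (@le_trans _ _ (\prod_(j < d) (2 * expR (2 * (lam * p 0 j) ^+ 2)))).
    by apply: ler_prod => j _; rewrite ler_cosh addr_ge0 ?expR_ge0.
  rewrite big_split /= prodr_const card_ord -expR_sum ler_wpM2l ?exprn_ge0 //.
  rewrite ler_expR; apply: (@le_trans _ _ (2 * lam ^+ 2 * dotv p p)).
    rewrite /dotv mulr_sumr; apply: ler_sum => j _.
    by rewrite le_eqVlt; apply/orP; left; apply/eqP; ring.
  by rewrite ler_wpM2l // mulr_ge0 // sqr_ge0.
apply: le_trans (ler_wpM2l (expR_ge0 _) le1) _.
rewrite mulrCA ler_wpM2l ?exprn_ge0 // -expRD ler_expR /lam.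
rewrite le_eqVlt; apply/orP; left; apply/eqP; field; lra.
Qed.

Lemma sign_tail_norm (p : 'rV[R]_d) (b s : R) : 0 < b -> dotv p p <= b ->
  0 <= s ->
  #|[pred a : signs d | s <= `|dotv (vec a) p| ]|%:R
    <= 2 * (2 ^+ d * expR (- (s ^+ 2 / (8 * b)))).
Proof.
move=> b0 pb s0.
have h1 := sign_tail b0 pb s0.
have pbN : dotv (- p) (- p) <= b by rewrite dotvNl dotvNr opprK.
have h2 := sign_tail b0 pbN s0.
rewrite mulr_natl mulr2n; apply: le_trans (lerD h1 h2).
rewrite -natrD ler_nat -cardUI; apply: leq_trans (leq_addr _ _).
apply: subset_leq_card; apply/fintype.subsetP => a.
by rewrite !inE dotvNr ler_normr.
Qed.

End SignVectors.

Lemma card_union_bound (R : numDomainType) (T Z : finType) (P : pred T) (Q : Z -> pred T) :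
  (forall a, P a -> exists z, Q z a) -> (#|P|%:R : R) <= \sum_z #|Q z|%:R.
Proof.
move=> h; rewrite -natr_sum ler_nat.
under eq_bigr do rewrite -sum1_card big_mkcond /=.
rewrite exchange_big /= -sum1_card big_mkcond /=.
apply: leq_sum => a _; case: ifP => // /h[z Qza].
by rewrite (bigD1 z) //= unfold_in Qza.
Qed.

(** * Concentration on low-dimensional subspaces *)

Section GramSchmidt.
Variables (R : realType) (d : nat).
Implicit Types (x q : nat -> 'rV[R]_d) (p : 'rV[R]_d).

(* Zero vectors are allowed, so that dependent families can be orthonormalized
   without changing their length. *)
Definition orthosys r q :=
  (forall i j, (i < r)%N -> (j < r)%N -> i != j -> dotv (q i) (q j) = 0) /\
  (forall i, (i < r)%N -> dotv (q i) (q i) = 0 \/ dotv (q i) (q i) = 1).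

Lemma orthosys_dotl r q (c : nat -> R) (l : 'I_r) : orthosys r q ->
  dotv (\sum_(i < r) c i *: q i) (q l) = c l * dotv (q l) (q l).
Proof.
move=> [orth _]; rewrite dotv_suml (bigD1 l) //= big1 ?addr0 ?dotvZl // => i il.
by rewrite dotvZl orth ?mulr0.
Qed.

Lemma orthosys_proj r q (c : nat -> R) p : orthosys r q ->
  p = \sum_(i < r) c i *: q i -> p = \sum_(i < r) dotv p (q i) *: q i.
Proof.
move=> oq hp; rewrite {1}hp; apply: eq_bigr => l _.
rewrite hp (orthosys_dotl c) //.
case: oq => _ /(_ _ (ltn_ord l))[/dotvv_eq0 ->|->]; first by rewrite !scaler0.
by rewrite mulr1.
Qed.

Lemma orthosys_sqnorm r q (c : nat -> R) p : orthosys r q ->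
  p = \sum_(i < r) c i *: q i -> dotv p p <= \sum_(i < r) c i ^+ 2.
Proof.
move=> oq hp; rewrite {2}hp dotv_sumr; apply: ler_sum => l _.
rewrite dotvZr hp (orthosys_dotl c) //.
case: oq => _ /(_ _ (ltn_ord l))[->|->]; first by rewrite !mulr0 sqr_ge0.
by rewrite mulr1 expr2.
Qed.

Lemma bessel r q p : orthosys r q ->
  \sum_(i < r) dotv p (q i) ^+ 2 <= dotv p p.
Proof.
move=> oq; pose s := \sum_(i < r) dotv p (q i) *: q i.
have ps : dotv p s = \sum_(i < r) dotv p (q i) ^+ 2.
  by rewrite dotv_sumr; apply: eq_bigr => i _; rewrite dotvZr expr2.
have ss := orthosys_sqnorm oq (erefl s : s = \sum_(i < r) (fun i => dotv p (q i)) i *: q i).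
rewrite /= in ss.
have := dotvv_ge0 (p - s); rewrite dotvBl !dotvBr (dotvC s p) ps.
lra.
Qed.

Lemma gram_schmidt r x : exists2 q, orthosys r q &
  forall i, (i < r)%N -> x i = \sum_(l < r) dotv (x i) (q l) *: q l.
Proof.
elim: r => [|r [q oq hx]]; first by exists x => //; split.
pose w := x r - \sum_(l < r) dotv (x r) (q l) *: q l.
(* The inverse of 0 is 0, so a dependent [x r] contributes the zero vector. *)
pose q' i := if i == r then (normv w)^-1 *: w else q i.
have q'lt i : (i < r)%N -> q' i = q i by move=> ir; rewrite /q' ltn_eqF.
have q'r : q' r = (normv w)^-1 *: w by rewrite /q' eqxx.
have wq i : (i < r)%N -> dotv w (q i) = 0.
  move=> ir; rewrite dotvBl (orthosys_dotl (fun l => dotv (x r) (q l)) (Ordinal ir)) //=.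
  case: oq => _ /(_ _ ir)[/dotvv_eq0 ->|->]; first by rewrite !dotv0r mulr0 subrr.
  by rewrite mulr1 subrr.
have oq' : orthosys r.+1 q'.
  case: oq => orth nrm; split => [i j|i].
    rewrite !ltnS (leq_eqVlt i) (leq_eqVlt j) => /orP[/eqP->|ir] /orP[/eqP->|jr].
    - by rewrite eqxx.
    - by rewrite q'r q'lt // dotvZl wq // mulr0.
    - by rewrite q'r q'lt // dotvZr dotvC wq // mulr0.
    - by rewrite !q'lt //; exact: orth.
  rewrite ltnS leq_eqVlt => /orP[/eqP->|ir]; last by rewrite q'lt //; exact: nrm.
  rewrite q'r dotvZl dotvZr -sqr_normv mulrA -expr2 -exprMn.
  have [->|nz] := eqVneq (normv w) 0; first by left; rewrite mulr0 expr0n.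
  by right; rewrite mulVf // expr1n.
exists q' => // i; rewrite ltnS leq_eqVlt => /orP[/eqP->|ir].
  rewrite big_ord_recr /= q'r.
  under eq_bigr => l _ do rewrite q'lt //.
  have -> : x r = w + \sum_(l < r) dotv (x r) (q l) *: q l by rewrite subrK.
  have -> : dotv (w + \sum_(l < r) dotv (x r) (q l) *: q l) ((normv w)^-1 *: w)
      = (normv w)^-1 * dotv w w.
    rewrite dotvZr; congr (_ * _); rewrite dotvDl dotv_suml big1 ?addr0 // => l _.
    by rewrite dotvZl (dotvC (q l)) wq // mulr0.
  rewrite scalerA mulrAC -invfM -expr2 sqr_normv.
  have -> : (dotv w w)^-1 * dotv w w *: w = w.
    have [/dotvv_eq0 ->|nz] := eqVneq (dotv w w) 0; first by rewrite scaler0.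
    by rewrite mulVf // scale1r.
  rewrite addrC; congr (_ + _).
  rewrite [LHS](@orthosys_proj r q (fun l => dotv (x r) (q l)) _ oq erefl).
  by apply: eq_bigr => l _; rewrite dotvDl wq // add0r.
rewrite big_ord_recr /= {1}hx // q'r.
have -> : dotv (x i) ((normv w)^-1 *: w) = 0.
  rewrite dotvZr hx // dotv_suml big1 ?mulr0 // => l _.
  by rewrite dotvZl (dotvC (q l)) wq // mulr0.
by rewrite scale0r addr0; apply: eq_bigr => l _; rewrite q'lt.
Qed.

(** Cauchy-Schwarz in the coordinates along [q], with Bessel's inequality for [p]. Hence correlation
    with a short vector of the span forces a large projection on the span. *)
Lemma dotv_span_le r q (p v : 'rV[R]_d) : orthosys r q ->
  p = \sum_(l < r) dotv p (q l) *: q l ->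
  dotv v p ^+ 2 <= dotv p p * \sum_(l < r) dotv v (q l) ^+ 2.
Proof.
move=> oq hp.
have -> : dotv v p = dotv (\row_(l < r) dotv p (q l)) (\row_(l < r) dotv v (q l)).
  rewrite {1}hp dotv_sumr; apply: eq_bigr => l _.
  by rewrite dotvZr !mxE.
apply: le_trans (dotv_CS _ _) _.
have e u : dotv (\row_(l < r) dotv u (q l)) (\row_(l < r) dotv u (q l)) =
    \sum_(l < r) dotv u (q l) ^+ 2.
  by apply: eq_bigr => l _; rewrite !mxE expr2.
rewrite !e ler_wpM2r ?bessel //.
by apply: sumr_ge0 => l _; exact: sqr_ge0.
Qed.

(* Rounding the coordinates of the projection to integers replaces the
   supremum over the span by a maximum over at most (4r+2)^r directions. *)
Lemma span_tail r q (t : R) : orthosys r q -> 0 < t ->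
  #|[pred a : signs d | t ^+ 2 <= \sum_(l < r) dotv (vec R a) (q l) ^+ 2]|%:R
    <= (4 * r + 2)%:R ^+ r * (2 ^+ d * expR (- (t ^+ 2 / 32))).
Proof.
move=> oq t0.
case: r oq => [|r'] oq.
  rewrite (_ : #|_| = 0%N) ?mulr_ge0 ?exprn_ge0 ?expR_ge0 //.
  apply: eq_card0 => a; rewrite !inE big_ord0.
  by apply/negbTE; rewrite -ltNge exprn_gt0.
set r := r'.+1 in oq *.
have r0 : 0 < (r%:R : R) by rewrite ltr0n.
have sr0 : 0 < Num.sqrt (r%:R : R) by rewrite sqrtr_gt0.
(* An integer point is encoded by signs and absolute values at most [2 * r], and extended by 0 to
   all natural indices. *)
pose zv (z : {ffun 'I_r -> bool * 'I_(2 * r).+1}) (l : nat) : R :=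
  if insub l is Some l' then (-1) ^+ (z l').1 * (z l').2%:R else 0.
have zvE z (l : 'I_r) : zv z l = (-1) ^+ (z l).1 * (z l).2%:R.
  by rewrite /zv valK.
pose Q z := [pred a : signs d | (\sum_(l < r) zv z l ^+ 2 <= 4 * r%:R) &&
  (Num.sqrt r%:R * t <= dotv (vec R a) (\sum_(l < r) zv z l *: q l))].
apply: (le_trans (card_union_bound R (Q := Q) _)).
  move=> a /=; set w := fun l => dotv (vec R a) (q l).
  set nw := Num.sqrt (\sum_(l < r) w l ^+ 2).
  have W0 : 0 <= \sum_(l < r) w l ^+ 2 by apply: sumr_ge0 => l _; exact: sqr_ge0.
  have nw2 : nw ^+ 2 = \sum_(l < r) w l ^+ 2 by rewrite sqr_sqrtr.
  rewrite -nw2 ler_sqr ?nnegrE ?sqrtr_ge0 ?(ltW t0) // => tnw.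
  have nw0 : 0 < nw by exact: lt_le_trans tnw.
  (* This scaling gives the projection length 2 sqrt r. Truncation then costs at most the sum of the
     [|w l|], which is at most sqrt r times [nw]: half of the inner product 2 sqrt r [nw]. *)
  pose al := 2 * Num.sqrt r%:R / nw.
  have al0 : 0 < al by rewrite divr_gt0 // mulr_gt0.
  have wle l : `|w (l : 'I_r)| <= nw.
    rewrite -(@ler_sqr R) ?nnegrE ?(ltW nw0) // real_normK ?num_real // nw2.
    by rewrite (bigD1 l) //= lerDl; apply: sumr_ge0 => i _; exact: sqr_ge0.
  have yle (l : 'I_r) : al * `|w l| <= 2 * Num.sqrt r%:R.
    by rewrite /al mulrAC ler_pdivrMr // ler_wpM2l // mulr_ge0 // ltW.
  have y0 (l : 'I_r) : 0 <= al * `|w l| by rewrite mulr_ge0 // ltW.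
  have srr : Num.sqrt (r%:R : R) <= r%:R.
    have h1 : 1 <= Num.sqrt (r%:R : R).
      have : Num.sqrt 1 <= Num.sqrt (r%:R : R) by rewrite ler_wsqrtr // ler1n.
      by rewrite sqrtr1.
    by rewrite -{2}(sqr_sqrtr (ltW r0)) expr2 ler_peMl // ltW.
  have tr (l : 'I_r) : (Num.truncn (al * `|w l|) < (2 * r).+1)%N.
    rewrite ltnS -(@ler_nat R); apply: (@le_trans _ _ (al * `|w l|)).
      by rewrite truncn_le.
    rewrite natrM; apply: le_trans (yle l) _.
    by rewrite ler_wpM2l.
  pose z := [ffun l : 'I_r => (w l < 0, Ordinal (tr l))].
  have zE (l : 'I_r) : zv z l = (-1) ^+ (w l < 0)%R * (Num.truncn (al * `|w l|))%:R.
    by rewrite zvE ffunE.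
  exists z; apply/andP; split.
    apply: (@le_trans _ _ (al ^+ 2 * nw ^+ 2)).
      rewrite nw2 mulr_sumr; apply: ler_sum => l _.
      rewrite zE exprMn sqrr_sign mul1r -exprMn -[leRHS]real_normK ?num_real //.
      rewrite normrM (gtr0_norm al0) ler_sqr ?nnegrE ?ler0n ?y0 //.
      by rewrite truncn_le.
    rewrite /al -exprMn divfK ?gt_eqF // exprMn sqr_sqrtr ?ler0n //.
    by rewrite -natrX.
  rewrite dotv_sumr.
  apply: (@le_trans _ _ (\sum_(l < r) (al * `|w l| - 1) * `|w l|)); last first.
    apply: ler_sum => l _; rewrite dotvZr zE -/(w l).
    rewrite [leRHS]mulrAC.
    have -> : (-1) ^+ (w l < 0)%R * w l = `|w l|.
      by rewrite -normrEsign.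
    rewrite [leRHS]mulrC ler_wpM2r // lerBlDr.
    have /andP[_] := truncn_itv (y0 l).
    by rewrite -natr1 => /ltW.
  have hS : \sum_(l < r) `|w l| <= Num.sqrt r%:R * nw.
    have S0 : 0 <= \sum_(l < r) `|w l| by apply: sumr_ge0.
    rewrite -(@ler_sqr R) ?nnegrE ?mulr_ge0 ?sqrtr_ge0 //.
    have := dotv_CS (\row_(l < r) `|w l|) (\row_(l < r) (1 : R)).
    rewrite /dotv; under eq_bigr do rewrite !mxE mulr1.
    under [X in _ <= X * _ -> _]eq_bigr do rewrite !mxE -expr2 real_normK ?num_real //.
    under [X in _ <= _ * X -> _]eq_bigr do rewrite !mxE mulr1.
    by rewrite sumr_const card_ord exprMn sqr_sqrtr ?ler0n // nw2 mulrC.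
  have -> : \sum_(l < r) (al * `|w l| - 1) * `|w l| = al * nw ^+ 2 - \sum_(l < r) `|w l|.
    rewrite nw2 mulr_sumr -sumrB; apply: eq_bigr => l _.
    by rewrite mulrBl mul1r -mulrA -expr2 real_normK ?num_real.
  have -> : al * nw ^+ 2 = 2 * (Num.sqrt r%:R * nw).
    by rewrite /al expr2 mulrA divfK ?gt_eqF // mulrA.
  have := ler_wpM2l (ltW sr0) tnw; lra.
apply: (@le_trans _ _ (\sum_(z : {ffun 'I_r -> bool * 'I_(2 * r).+1})
    2 ^+ d * expR (- (t ^+ 2 / 32)))); last first.
  rewrite sumr_const card_ffun card_prod card_bool !card_ord -[leLHS]mulr_natl natrX.
  rewrite le_eqVlt; apply/orP; left; apply/eqP; congr (_ ^+ _ * _).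
  by congr (_%:R); lia.
apply: ler_sum => z _.
have [hz|hz] := leP (\sum_(l < r) zv z l ^+ 2) (4 * r%:R); last first.
  rewrite (_ : #|_| = 0%N) ?mulr_ge0 ?exprn_ge0 ?expR_ge0 //.
  by apply: eq_card0 => a; rewrite !inE leNgt hz.
have b0 : 0 < 4 * (r%:R : R) by rewrite mulr_gt0.
have pb := le_trans (orthosys_sqnorm oq erefl) hz.
have s0 : 0 <= Num.sqrt (r%:R : R) * t by rewrite mulr_ge0 // ltW.
have := sign_tail b0 pb s0.
have -> : (Num.sqrt (r%:R : R) * t) ^+ 2 / (8 * (4 * r%:R)) = t ^+ 2 / 32.
  by rewrite exprMn sqr_sqrtr ?ler0n //; field; rewrite gt_eqF.
apply: le_trans; rewrite ler_nat; apply: subset_leq_card.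
by apply/fintype.subsetP => a; rewrite !inE => /andP[].
Qed.

End GramSchmidt.

(** * Sign vectors nearly orthogonal to a spread family *)

Section Minors.
Variables (R : realType) (d K : nat) (x : nat -> 'rV[R]_d).
Hypothesis x_le1 : forall i j, (i < K)%N -> `|x i 0 j| <= 1.

Definition minor r (I : 'I_r -> 'I_K) (J : 'I_r -> 'I_d) : 'M[R]_r :=
  \matrix_(a, b) x (I a) 0 (J b).

(* Repeated rows and columns are allowed: they only contribute zero minors. *)
Definition maxminor r : R :=
  \big[Num.max/0]_(p : {ffun 'I_r -> 'I_K} * {ffun 'I_r -> 'I_d})
    `|\det (minor p.1 p.2)|.

Lemma maxminor_ge0 r : 0 <= maxminor r.
Proof. exact: bigmax_ge_id. Qed.

Lemma le_maxminor r (I : 'I_r -> 'I_K) (J : 'I_r -> 'I_d) :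
  `|\det (minor I J)| <= maxminor r.
Proof.
have -> : minor I J = minor [ffun a => I a] [ffun b => J b].
  by apply/matrixP => a b; rewrite !mxE !ffunE.
by apply: (le_trans _ (le_bigmax _ _ ([ffun a => I a], [ffun b => J b]))).
Qed.

Lemma maxminor_attained r : 0 < maxminor r ->
  exists I J, `|\det (@minor r I J)| = maxminor r.
Proof.
move=> f0; apply: contrapT => h.
suff : maxminor r < maxminor r by rewrite ltxx.
rewrite {1}/maxminor; apply: bigmax_lt => // -[I J] _ /=.
rewrite lt_neqAle le_maxminor andbT; apply/eqP => e.
by apply: h; exists I, J.
Qed.

Lemma cofactor_minor_le r (I : 'I_r.+1 -> 'I_K) (J : 'I_r.+1 -> 'I_d) i j :
  `|cofactor (minor I J) i j| <= maxminor r.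
Proof.
rewrite /cofactor normrM normrX normrN1 expr1n mul1r.
apply: le_trans (le_maxminor (fun a => I (lift i a)) (fun b => J (lift j b))).
rewrite le_eqVlt; apply/orP; left; apply/eqP; congr (`|\det _|).
by apply/matrixP => a b; rewrite !mxE.
Qed.

(** Laplace expansion along the first row, whose entries are at most 1. *)
Lemma maxminorS_le r : maxminor r.+1 <= r.+1%:R * maxminor r.
Proof.
apply: bigmax_le => [|[I J] _ /=]; first by rewrite mulr_ge0 ?maxminor_ge0.
rewrite (expand_det_row _ ord0); apply: le_trans (ler_norm_sum _ _ _) _.
apply: (@le_trans _ _ (\sum_(j < r.+1) maxminor r)); last first.
  by rewrite sumr_const card_ord mulr_natl.
apply: ler_sum => j _; rewrite normrM -[leRHS]mul1r ler_pM //.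
  by rewrite mxE x_le1.
exact: cofactor_minor_le.
Qed.

Lemma maxminor_le r : (r <= K)%N -> maxminor r <= K%:R ^+ r.
Proof.
elim: r => [_|r IH rK].
  by rewrite expr0; apply: bigmax_le => // -[I J] _ /=; rewrite det_mx00 normr1.
apply: le_trans (maxminorS_le r) _; rewrite exprS ler_pM ?maxminor_ge0 //.
  by rewrite ler_nat.
by apply: IH; exact: ltnW.
Qed.

(** Cramer's rule through the adjugate. Cofactors are minors of order [r], so the ratio of
    consecutive maximal minors controls the error. *)
Lemma cramer_bound r (I : 'I_r.+1 -> 'I_K) (J : 'I_r.+1 -> 'I_d)
    (e : R) (y : 'cV[R]_r.+1) :
  (forall i, `|(minor I J *m y) i 0| <= e) ->
  forall j, `|\det (minor I J)| * `|y j 0| <= r.+1%:R * maxminor r * e.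
Proof.
move=> h j; rewrite -normrM.
have -> : \det (minor I J) * y j 0 = \sum_i cofactor (minor I J) i j * (minor I J *m y) i 0.
  have := congr1 (fun M : 'M[R]_r.+1 => (M *m y) j 0) (mul_adj_mx (minor I J)).
  rewrite -mulmxA mul_scalar_mx !mxE => <-.
  by apply: eq_bigr => i _; rewrite !mxE.
apply: le_trans (ler_norm_sum _ _ _) _.
apply: (@le_trans _ _ (\sum_(i < r.+1) maxminor r * e)); last first.
  by rewrite sumr_const card_ord -[leLHS]mulr_natl mulrA.
by apply: ler_sum => i _; rewrite normrM ler_pM // cofactor_minor_le.
Qed.

Variable rho : R.
Hypotheses (rho_gt0 : 0 < rho) (d_gt0 : (0 < d)%N).

Definition far_chain := forall i, (i < K)%N -> forall c : nat -> R,
  rho <= normv (x i - \sum_(l < i) c l *: x l).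

Hypothesis x_far : far_chain.

Let sd : R := Num.sqrt d%:R.
Let sd_gt0 : 0 < sd. Proof. by rewrite sqrtr_gt0 ltr0n. Qed.

(** Columns are chosen greedily. Eliminating the new row by the earlier ones (a Schur complement)
    multiplies the determinant by a coordinate of [x i] minus a combination of its predecessors, and
    by [far_chain] some coordinate of that difference is at least [rho / sd]. *)
Lemma leading_minor i : (i <= K)%N -> exists J : nat -> 'I_d,
  (rho / sd) ^+ i <= `|\det (\matrix_(a < i, b < i) x a 0 (J b))|.
Proof.
elim: i => [_|i IH iK].
  by exists (fun=> Ordinal d_gt0); rewrite det_mx00 normr1 expr0.
have [J hJ] := IH (ltnW iK).
set Y := \matrix_(a < i, b < i) x a 0 (J b) in hJ.
have rs0 : 0 < (rho / sd) ^+ i by rewrite exprn_gt0 // divr_gt0.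
have Yu : Y \in unitmx by rewrite unitmxE unitfE -normr_gt0; exact: lt_le_trans hJ.
pose c : 'rV_i := (\row_b x i 0 (J b)) *m invmx Y.
pose cn l : R := if insub l is Some l' then c 0 (l' : 'I_i) else 0.
have [j hj] := ex_large_coord d_gt0 (ltW rho_gt0) (x_far iK cn).
exists (fun b => if b == i then j else J b).
rewrite -addn1; set M := \matrix_(_, _) _.
have -> : M = block_mx Y (\col_a x a 0 j) (\row_b x i 0 (J b)) (x i 0 j)%:M.
  rewrite -[M]submxK; congr block_mx; apply/matrixP => a b.
  - by rewrite !mxE /= ltn_eqF.
  - by rewrite !mxE /= !ord1 /= addn0 eqxx.
  - by rewrite !mxE /= !ord1 /= addn0 ltn_eqF.
  - by rewrite !mxE /= !ord1 /= addn0 !eqxx.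
have -> : block_mx Y (\col_a x a 0 j) (\row_b x i 0 (J b)) (x i 0 j)%:M =
    block_mx 1%:M 0 c 1%:M *m
    block_mx Y (\col_a x a 0 j) 0 ((x i 0 j)%:M - c *m \col_a x a 0 j).
  rewrite (mulmx_block 1%:M) !mul1mx !mul0mx !addr0.
  by rewrite /c mulmxKV // addrC subrK.
rewrite det_mulmx det_lblock det_ublock !det1 !mul1r det_mx11 normrM exprD expr1.
rewrite ler_pM ?exprn_ge0 ?divr_ge0 ?(ltW rho_gt0) ?(ltW sd_gt0) //.
apply: le_trans hj _; rewrite le_eqVlt; apply/orP; left; apply/eqP; congr `|_|.
rewrite !mxE !eqxx mulr1n; congr (_ - _).
rewrite summxE; apply: eq_bigr => l _; rewrite !mxE.
by congr (_ * _); rewrite /cn valK /c mxE.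
Qed.

Lemma maxminor_ge : (rho / sd) ^+ K <= maxminor K.
Proof.
have [J hJ] := leading_minor (leqnn K); apply: le_trans hJ _.
exact: (le_maxminor id (fun b => J b)).
Qed.

(** If one maximal minor vanished, expansion would make all larger ones vanish, against
    [maxminor_ge]. *)
Lemma maxminor_gt0 r : (r <= K)%N -> 0 < maxminor r.
Proof.
move=> rK; rewrite lt_neqAle maxminor_ge0 andbT eq_sym; apply/eqP => f0.
have f0' t : (r <= t)%N -> maxminor t <= 0.
  elim: t => [|t IH]; first by rewrite leqn0 => /eqP <-; rewrite f0.
  rewrite leq_eqVlt ltnS => /orP[/eqP <-|/IH ft]; first by rewrite f0.
  by apply: le_trans (maxminorS_le t) _; rewrite mulr_ge0_le0.
have := le_trans maxminor_ge (f0' _ rK).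
by rewrite leNgt exprn_gt0 // divr_gt0.
Qed.

(** If all ratios between orders [h] and [K] were below [s], then [maxminor K] would be below
    [s ^+ h * K%:R ^+ h], which is [(rho / sd) ^+ K], against [maxminor_ge]. The factor [K] in the
    denominator of [s] cancels the bound on [maxminor h]. *)
Lemma ex_balanced_minor h : K = (2 * h)%N -> (0 < h)%N ->
  exists2 r, (h <= r < K)%N &
  rho ^+ 2 / (d%:R * K%:R) * maxminor r <= maxminor r.+1.
Proof.
move=> Kh h0; apply: contrapT => hn.
set s := rho ^+ 2 / (d%:R * K%:R) in hn.
have K0 : (0 < K)%N by lia.
have s0 : 0 < s by rewrite divr_gt0 ?exprn_gt0 // mulr_gt0 // ltr0n.
have {}hn r : (h <= r < K)%N -> maxminor r.+1 < s * maxminor r.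
  by move=> hr; rewrite ltNge; apply/negP => le; apply: hn; exists r.
have hle t : (h + t <= K)%N -> maxminor (h + t) <= s ^+ t * maxminor h.
  elim: t => [_|t IH ht]; first by rewrite addn0 expr0 mul1r.
  rewrite addnS in ht *; have ht' : (h <= h + t < K)%N by lia.
  apply: le_trans (ltW (hn _ ht')) _; rewrite exprS -mulrA ler_wpM2l ?(ltW s0) //.
  by apply: IH; lia.
have hK : (h <= K.-1 < K)%N by lia.
have := hn _ hK; rewrite prednK //.
have e : K.-1 = (h + h.-1)%N by lia.
have hle' := hle h.-1; rewrite -e in hle'.
have {}hle' := ler_wpM2l (ltW s0) (hle' (leq_pred K)).
rewrite mulrA -exprS prednK // in hle'.
move=> lt1; have {lt1 hle'} := lt_le_trans lt1 hle'.
have hK' : (h <= K)%N by lia.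
have le2 := ler_wpM2l (exprn_ge0 h (ltW s0)) (maxminor_le hK').
move=> lt1; have {lt1 le2} := le_lt_trans maxminor_ge (lt_le_trans lt1 le2).
rewrite {1}Kh exprM -exprMn ltNge => /negP; apply.
rewrite le_eqVlt; apply/orP; left; apply/eqP; congr (_ ^+ _).
rewrite exprMn exprVn /sd sqr_sqrtr ?ler0n // /s.
by field; rewrite !pnatr_eq0 -!lt0n K0 d_gt0.
Qed.

(* On a well-conditioned minor Cramer's rule determines the signs in its
   columns from the remaining ones. *)
Lemma card_near_kernel h (tau : R) : K = (2 * h)%N -> (0 < h)%N ->
  d%:R * K%:R ^+ 2 * tau < rho ^+ 2 ->
  (#|[pred a : signs d | [forall i : 'I_K, `|dotv (vec R a) (x i)| <= tau]%R]|
     * 2 ^ h <= 2 ^ d)%N.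
Proof.
move=> Kh h0 htau.
have K0 : (0 < K)%N by lia.
have [r /andP[hr rK] hf] := ex_balanced_minor Kh h0.
have fr1 := maxminor_gt0 rK.
have [I [J hIJ]] := maxminor_attained fr1.
have Jinj : injective J.
  move=> b b' e; apply/eqP; apply: contraT => nb.
  have : \det (minor I J) = 0.
    rewrite -det_tr; apply: (determinant_alternate nb) => a.
    by rewrite !mxE e.
  by move=> e0; move: fr1; rewrite -hIJ e0 normr0 ltxx.
set A := [pred a | _].
apply: (@leq_trans (#|A| * 2 ^ r.+1)%N).
  by rewrite leq_mul2l leq_exp2l // (leq_trans hr) ?orbT.
(* [phi] overwrites the columns of the minor by arbitrary signs; its injectivity on [A] times all
   sign patterns gives the count. *)
pose phi (p : signs d * {ffun 'I_r.+1 -> bool}) : signs d :=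
  [ffun j => if [pick b | J b == j] is Some b then p.2 b else p.1 j].
have phiJ p b : phi p (J b) = p.2 b.
  by rewrite ffunE; case: pickP => [b' /eqP/Jinj -> //|/(_ b)]; rewrite eqxx.
have phiN p j : (forall b, J b != j) -> phi p j = p.1 j.
  by move=> hj; rewrite ffunE; case: pickP => // b; rewrite (negbTE (hj b)).
rewrite -!card_signs.
rewrite -(cardX A predT).
apply: (@leq_card_in _ _ phi) => //.
move=> -[a e] [a' e'] /andP[/= aA _] /andP[/= a'A _] E.
have ee : e = e' by apply/ffunP => b; have := congr1 (fun f : signs d => f (J b)) E; rewrite !phiJ.
have aN j : (forall b, J b != j) -> a j = a' j.
  by move=> hj; have := congr1 (fun f : signs d => f j) E; rewrite !phiN.
congr (_, _) => //; apply/ffunP => j.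
have [[b <-]|hj] := pselect (exists b, J b = j); last first.
  by apply: aN => b; apply/eqP => bj; apply: hj; exists b.
(* The two vectors agree off the columns [J], so the minor maps [y] to differences of inner products
   with the points [x (I i)]. *)
pose y : 'cV[R]_r.+1 := \col_b (vec R a - vec R a') 0 (J b).
have hy i : `|(minor I J *m y) i 0| <= 2 * tau.
  have -> : (minor I J *m y) i 0 = dotv (vec R a) (x (I i)) - dotv (vec R a') (x (I i)).
    rewrite -dotvBl /dotv mxE.
    rewrite (bigID (fun j => j \in [set J b | b : 'I_r.+1]%SET)) /=.
    rewrite [X in _ = _ + X]big1 ?addr0; last first.
      move=> j' hj'; rewrite !mxE aN ?subrr ?mul0r // => b'.
      by apply: contra hj' => /eqP <-; exact: imset_f.
    rewrite big_imset /=; last by move=> ? ? _ _; exact: Jinj.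
    by apply: eq_bigr => b' _; rewrite !mxE mulrC.
  have := forallP aA (I i); have := forallP a'A (I i).
  have := ler_normB (dotv (vec R a) (x (I i))) (dotv (vec R a') (x (I i))); lra.
have := cramer_bound hy b; rewrite hIJ => le1.
(* A difference of two signs has absolute value 0 or 2, so a bound below 2 forces equality. *)
have y2 : `|y b 0| < 2.
  rewrite ltNge; apply/negP => y2.
  have tau0 : 0 <= tau by apply: le_trans (normr_ge0 _) (forallP aA (I b)).
  have f0 : 0 < maxminor r by apply: maxminor_gt0; exact: ltnW.
  have le3 : rho ^+ 2 / (d%:R * K%:R) * maxminor r <= r.+1%:R * tau * maxminor r.
    by apply: le_trans hf _; nra.
  rewrite ler_pM2r // ler_pdivrMr ?mulr_gt0 ?ltr0n // in le3.
  have rK' : (r.+1%:R : R) <= K%:R by rewrite ler_nat.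
  have dK0 : 0 <= tau * (d%:R * (K%:R : R)) by rewrite !mulr_ge0.
  have := ler_wpM2r dK0 rK'; nra.
move: y2; rewrite !mxE; case: (a _) (a' _) => -[] //=.
  rewrite expr1 expr0 -opprD normrN ger0_norm //; lra.
rewrite expr1 expr0 opprK ger0_norm //; lra.
Qed.

End Minors.

(** * Counting tools *)

Section Resampling.
Variables (J T : finType).
Implicit Types (L : {set J}) (V W : {ffun J -> T}).

(** Redraws the coordinates in [L] and keeps the others: the counting substitute for
    conditioning. *)
Definition mix L V W : {ffun J -> T} := [ffun j => if j \in L then W j else V j].

Lemma mixE L V W j : mix L V W j = if j \in L then W j else V j.
Proof. by rewrite ffunE. Qed.

(* (V, W) |-> (mix V W, mix W V) is an involution. *)
Lemma sum_card_mix L (E : pred {ffun J -> T}) :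
  (\sum_V #|[pred W | E (mix L V W)]| = #|{ffun J -> T}| * #|E|)%N.
Proof.
have mixK V W : mix L (mix L V W) (mix L W V) = V.
  by apply/ffunP => j; rewrite !mixE; case: (j \in L).
have inv : involutive (fun p : {ffun J -> T} * {ffun J -> T} =>
    (mix L p.1 p.2, mix L p.2 p.1)) by move=> [V W] /=; rewrite !mixK.
transitivity (\sum_V \sum_W (E (mix L V W) : nat))%N.
  by apply: eq_bigr => V _; rewrite -sum1_card big_mkcond.
rewrite pair_big /= (reindex_inj (inv_inj inv)) /=.
under eq_bigr do rewrite mixK.
rewrite -(pair_big xpredT xpredT (fun V W => (E V : nat))) /=.
under eq_bigr do rewrite sum_nat_const.
rewrite -big_distrr /=; congr (_ * _)%N.
by rewrite -sum1_card [RHS]big_mkcond.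
Qed.

(** A bound on the conditional probability, uniform in the coordinates outside [L], bounds the
    probability. *)
Lemma card_mix_le (R : numDomainType) L (E : pred {ffun J -> T}) (q : R) :
  (forall V, #|[pred W | E (mix L V W)]|%:R <= q * #|{ffun J -> T}|%:R) ->
  #|E|%:R <= q * #|{ffun J -> T}|%:R.
Proof.
move=> h; have [T0|T0] := posnP #|{ffun J -> T}|.
  by rewrite (_ : #|E| = 0%N) ?T0 ?mulr0 //; apply/eqP; rewrite -leqn0 -T0 max_card.
rewrite -(@ler_pM2l _ #|{ffun J -> T}|%:R) ?ltr0n // -natrM -(sum_card_mix L) natr_sum.
apply: le_trans (ler_sum _ (fun V _ => h V)) _.
by rewrite sumr_const -[leLHS]mulr_natl.
Qed.

(** Independence of the coordinates, written without division. *)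
Lemma card_constrained L (Q : pred T) :
  (#|[pred W : {ffun J -> T} | [forall j in L, Q (W j)]]| * #|T| ^ #|L| =
   #|Q| ^ #|L| * #|{ffun J -> T}|)%N.
Proof.
pose F j := if j \in L then Q else predT.
have -> : #|[pred W : {ffun J -> T} | [forall j in L, Q (W j)]]| = #|family F|.
  apply: eq_card => W; rewrite !inE; apply/forall_inP/familyP => h j.
    by rewrite /F; case: ifP => // /h; rewrite unfold_in.
  by move=> jL; have := h j; rewrite /F jL unfold_in.
rewrite card_family foldrE big_map -/(index_enum _) big_enum /=.
have -> : (\prod_(j in J) #|F j| = \prod_j (if j \in L then #|Q| else #|T|))%N.
  by apply: eq_bigr => j _; rewrite /F; case: (j \in L).
rewrite big_if /= !prod_nat_const card_ffun -mulnA; congr (_ * _)%N.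
by rewrite -expnD addnC; congr (_ ^ _)%N; rewrite -(cardC (mem L)).
Qed.

End Resampling.

Lemma card_marginal (R : numDomainType) (J T : finType) (l : J) (Q : pred T) (q : R) :
  #|Q|%:R <= q * #|T|%:R ->
  #|[pred W : {ffun J -> T} | Q (W l)]|%:R <= q * #|{ffun J -> T}|%:R.
Proof.
move=> hQ.
have := card_constrained [set l] Q; rewrite cards1 !expn1.
have -> : #|[pred W : {ffun J -> T} | [forall j in [set l]%SET, Q (W j)]]| =
          #|[pred W : {ffun J -> T} | Q (W l)]|.
  apply: eq_card => W; rewrite !inE; apply/forall_inP/idP => [h|h j].
    by apply: h; rewrite inE.
  by rewrite inE => /eqP ->.
have [T0 _|T0 e] := posnP #|T|.
  suff -> : #|[pred W : {ffun J -> T} | Q (W l)]| = 0%N.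
    rewrite (_ : #|{ffun J -> T}| = 0%N) ?mulr0 //.
    by apply: eq_card0 => W; have := fintype0 (W l) T0.
  by apply: eq_card0 => W; have := fintype0 (W l) T0.
rewrite -(@ler_pM2r _ #|T|%:R) ?ltr0n // -natrM e natrM mulrAC.
by rewrite ler_wpM2r.
Qed.

(** Greedy construction: elements are added in front, tails of valid lists are valid, and every
    valid list shorter than [K] has at least [a] extensions. *)
Lemma card_tuples_ge (R : numDomainType) (X : finType) (valid : pred (seq X)) (a : R) K :
  0 <= a -> valid [::] -> (forall x s, valid (x :: s) -> valid s) ->
  (forall s, (size s < K)%N -> valid s -> a <= #|[pred x | valid (x :: s)]|%:R) ->
  a ^+ K <= #|[pred t : K.-tuple X | valid t]|%:R.
Proof.
move=> a0 v0 vS; elim: K => [_|k IH h].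
  by rewrite expr0 ler1n; apply/card_gt0P; exists [tuple]; rewrite inE.
apply: (@le_trans _ _ (a * #|[pred t : k.-tuple X | valid t]|%:R)).
  by rewrite exprS ler_wpM2l // IH // => s sk; apply: h; rewrite ltnS ltnW.
rewrite -!sum1_card !natr_sum mulr_sumr.
pose cns (p : k.-tuple X * X) : k.+1.-tuple X := [tuple of p.2 :: p.1].
rewrite (reindex cns) /=; last first.
  exists (fun t : k.+1.-tuple X => (behead_tuple t : k.-tuple X, thead t)) => [[t x] _|t _].
    by congr pair; apply: val_inj.
  by rewrite /cns /= -tuple_eta.
rewrite -(pair_big_dep xpredT (fun t x => valid (x :: tval t)) (fun _ _ => 1%:R)) /=.
rewrite [leLHS]big_mkcond /=; apply: ler_sum => t _.
rewrite inE; case: ifP => vt; last by apply: sumr_ge0.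
rewrite mulr1; apply: le_trans (h t _ vt) _; first by rewrite size_tuple.
by rewrite -sum1_card natr_sum.
Qed.

(** Each factor (n - m - i) / (n - i) of the quotient, for i < u, is at least 7/8. *)
Lemma bin_ratio n m u : (8 * m + 8 * u <= n)%N ->
  (7 ^ u * 'C(n, u) <= 8 ^ u * 'C(n - m, u))%N.
Proof.
elim: u => [|u IH] h; first by rewrite !bin0.
have /IH {}IH : (8 * m + 8 * u <= n)%N by lia.
have e1 : (u.+1 * 'C(n, u.+1) = (n - u) * 'C(n, u))%N by rewrite mul_bin_left.
have e2 : (u.+1 * 'C(n - m, u.+1) = (n - m - u) * 'C(n - m, u))%N by rewrite mul_bin_left.
rewrite -(@leq_pmul2l u.+1) // mulnCA e1 [leqRHS]mulnCA e2 !expnS.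
have h7 : (7 * (n - u) <= 8 * (n - m - u))%N by lia.
have := leq_mul h7 IH; lia.
Qed.

(** * The memory game *)

Section Game.
Variables (R : realType) (d n K h m u : nat) (Mem Theta : finType).
Variable vv : Theta -> signs d.
Notation mats := {ffun 'I_n -> signs d}.
Variables (Enc : mats -> Mem).
(* [Y U M A th t] is the [t]-th query made from memory state [M] when the rows
   in [U] are hidden from the oracle, [th] being the hidden vectors. *)
Variable Y : {set 'I_n} -> Mem -> mats -> Theta -> nat -> 'rV[R]_d.
Variables (beta rho tau qc : R).
Hypotheses (K_even : K = (2 * h)%N) (h_gt0 : (0 < h)%N) (d_gt0 : (0 < d)%N).
Hypotheses (rho_gt0 : 0 < rho) (rho_le1 : rho <= 1) (beta_gt0 : 0 < beta).
Hypothesis rho_beta : Num.sqrt d%:R * rho <= beta.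
Hypothesis tau_small : d%:R * K%:R ^+ 2 * tau < rho ^+ 2.
Hypothesis Y_off : forall (U : {set 'I_n}) M (A A' : mats) th t,
  (forall j, j \notin U -> A j = A' j) -> Y U M A th t = Y U M A' th t.
Hypothesis v_spread : forall r q, (r <= K)%N -> orthosys r q ->
  #|[pred th | (beta / 2) ^+ 2 <= \sum_(l < r) dotv (vec R (vv th)) (q l) ^+ 2]|%:R
    <= qc * #|Theta|%:R.

Implicit Types (U : {set 'I_n}).

Definition good U M (A : mats) th t : bool := `[< normv (Y U M A th t) <= 1 /\
  (forall j, j \in U -> `|dotv (vec R (A j)) (Y U M A th t)| <= tau) /\
  dotv (vec R (vv th)) (Y U M A th t) <= - (2 * beta) >].

(** Let [p] be a point of the span within [rho] of a winning query. It has norm at most 2, and since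
    sqrt d times [rho] is at most [beta] its inner product with the hidden vector is at most
    [- beta]. So the hidden vector has projection at least [beta / 2] on the span, which [v_spread]
    makes rare. *)
Lemma card_near_span_le U M A (y : nat -> 'rV[R]_d) r : (r <= K)%N ->
  #|[pred th | `[< exists2 t, good U M A th t & exists c : nat -> R,
      normv (Y U M A th t - \sum_(l < r) c l *: y l) < rho >] ]|%:R
    <= qc * #|Theta|%:R.
Proof.
move=> rK; have [q oq hq] := gram_schmidt r y.
apply: le_trans (v_spread rK oq); rewrite ler_nat; apply: subset_leq_card.
apply/fintype.subsetP => th; rewrite !inE.
move=> [t /asboolP[xn [_ xv]] [c xc]].
set x := Y U M A th t in xn xv xc; set p := \sum_(l < r) _ in xc.
set v := vec R (vv th) in xv *.
have hp : p = \sum_(k < r) dotv p (q k) *: q k.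
  apply: (orthosys_proj (c := fun k => \sum_(l < r) c l * dotv (y l) (q k)) oq).
  rewrite /p; under eq_bigr => l _ do rewrite hq // scaler_sumr.
  rewrite exchange_big /=; apply: eq_bigr => k _.
  by rewrite scaler_suml; apply: eq_bigr => l _; rewrite scalerA.
have pn : dotv p p <= 4.
  have : normv p <= 2.
    have -> : p = x - (x - p) by rewrite opprB addrC subrK.
    apply: le_trans (normvD _ _) _; rewrite normvN.
    have := rho_le1; move: xn xc; lra.
  by rewrite normv_le // -natrX.
have vp : dotv v p <= - beta.
  have -> : p = x - (x - p) by rewrite opprB addrC subrK.
  rewrite dotvBr.
  have := ler_dotv v (x - p); rewrite normv_vec => h1.
  have h2 := ler_wpM2l (sqrtr_ge0 (d%:R : R)) (ltW xc).
  have := ler_norm (- dotv v (x - p)); rewrite normrN; have := rho_beta; lra.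
have := dotv_span_le v oq hp; set S := \sum_(l < r) _ => hS.
have S0 : 0 <= S by apply: sumr_ge0 => l _; exact: sqr_ge0.
have b0 := beta_gt0.
have : beta ^+ 2 <= dotv v p ^+ 2 by nra.
nra.
Qed.

Definition pt U M (A : mats) (xi : Theta * 'I_m.+1) := Y U M A xi.1 xi.2.

(** The newest point is the head; [rev] numbers the earlier ones from the oldest, in the order in
    which [far_chain] needs them. *)
Fixpoint valid U M (A : mats) (s : seq (Theta * 'I_m.+1)) : bool :=
  if s is xi :: s' then
    [&& good U M A xi.1 xi.2,
        `[< forall c : nat -> R, rho <= normv (pt U M A xi -
              \sum_(l < size s') c l *: pt U M A (nth xi (rev s') l)) >] &
        valid U M A s']
  else true.

(** Turns the recursion into the indexed form of [far_chain]. *)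
Lemma valid_far U M A s xi0 : valid U M A s -> forall i, (i < size s)%N ->
  good U M A (nth xi0 (rev s) i).1 (nth xi0 (rev s) i).2 /\
  forall c : nat -> R, rho <= normv (pt U M A (nth xi0 (rev s) i) -
    \sum_(l < i) c l *: pt U M A (nth xi0 (rev s) l)).
Proof.
elim: s => [|xi s IH] //= /and3P[xig /asboolP xif sv] i.
have nthlt l : (l < size s)%N -> nth xi0 (rev (xi :: s)) l = nth xi0 (rev s) l.
  by move=> ls; rewrite rev_cons nth_rcons size_rev ls.
rewrite ltnS leq_eqVlt => /orP[/eqP ->|is'].
  have nths : nth xi0 (rev (xi :: s)) (size s) = xi.
    by rewrite rev_cons nth_rcons size_rev ltnn eqxx.
  rewrite nths; split=> // c; have := xif c.
  under eq_bigr => l _ do rewrite (set_nth_default xi0) ?size_rev //.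
  by under [in X in _ -> X]eq_bigr => l _ do rewrite nthlt //.
have [g f] := IH sv i is'.
rewrite nthlt //; split=> // c.
by under eq_bigr => l _ do rewrite nthlt ?(ltn_trans _ is') //; exact: f.
Qed.

(* Off [U] the points of the tuple are functions of the rest of [A], so each row
   in [U] is confined by [card_near_kernel]. *)
Lemma card_valid U M (t : K.-tuple (Theta * 'I_m.+1)) :
  #|[pred A | valid U M A t]|%:R <= (2 ^+ (h * #|U|))^-1 * #|{: mats}|%:R :> R.
Proof.
apply: (@card_mix_le _ _ _ U (fun A => valid U M A t)) => V.
set E := [pred W | _].
have [E0|/card_gt0P[W0 W0E]] := posnP #|E|.
  by rewrite E0 mulr_ge0 // invr_ge0 exprn_ge0.
have K_gt0 : (0 < K)%N by lia.
have xi0 : Theta * 'I_m.+1 by exact: tnth t (Ordinal K_gt0).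
pose x i := pt U M V (nth xi0 (rev t) i).
have ptV W xi : pt U M (mix U V W) xi = pt U M V xi.
  by apply: Y_off => j jU; rewrite mixE (negbTE jU).
have sK : size t = K by rewrite size_tuple.
have hv W : W \in E -> forall i, (i < K)%N ->
  normv (x i) <= 1 /\ (forall j, j \in U -> `|dotv (vec R (W j)) (x i)| <= tau) /\
  forall c : nat -> R, rho <= normv (x i - \sum_(l < i) c l *: x l).
  rewrite inE => /(valid_far xi0) hW i iK; rewrite sK in hW.
  have [/asboolP[g1 [g2 _]] f] := hW i iK.
  rewrite -/(pt U M (mix U V W) _) ptV in g1 g2.
  split=> //; split=> [j jU|c]; first by have := g2 j jU; rewrite mixE jU.
  by have := f c; rewrite ptV; under eq_bigr => l _ do rewrite ptV.
have x1 i j : (i < K)%N -> `|x i 0 j| <= 1.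
  move=> iK; apply: le_trans (ler_coord_normv _ _) _.
  by have [] := hv _ W0E i iK.
have xfar : far_chain K x rho by move=> i iK; have [_ []] := hv _ W0E i iK.
have hQ := card_near_kernel x1 rho_gt0 d_gt0 xfar K_even h_gt0 tau_small.
set Q := [pred a | _] in hQ.
have EQ : (#|E| <= #|[pred W : mats | [forall j in U, Q (W j)]]|)%N.
  apply: subset_leq_card; apply/fintype.subsetP => W WE; rewrite inE.
  apply/forall_inP => j jU; apply/forallP => i.
  by have [_ [+ _]] := hv _ WE i (ltn_ord i); apply.
have := card_constrained U Q; rewrite card_signs => e.
have p2 k : (0 < 2 ^ k)%N by rewrite expn_gt0.
rewrite mulrC ler_pdivlMr ?exprn_gt0 // -natrX -natrM ler_nat.
rewrite -(@leq_pmul2r ((2 ^ d) ^ #|U|)) ?expn_gt0 ?p2 //.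
apply: (@leq_trans (#|[pred W : mats | [forall j in U, Q (W j)]]| *
    (2 ^ d) ^ #|U| * 2 ^ (h * #|U|))%N).
  by rewrite mulnAC leq_mul2r leq_mul2r EQ !orbT.
rewrite e mulnAC expnM -expnMn mulnC leq_mul2l; apply/orP; right.
by case: #|U| => // k; rewrite leq_exp2r.
Qed.

Variables (p : R) (Win : pred (mats * Theta)).
Hypothesis p_gt0 : 0 < p.
Hypothesis n_large : (8 * m + 8 * u <= n)%N.
Hypothesis WinP : forall A th, Win (A, th) -> exists2 t, (t <= m)%N &
  exists2 Q : {set 'I_n}, (#|Q| <= m)%N &
  forall U : {set 'I_n}, U \subset ~: Q -> good U (Enc A) A th t.
Hypothesis Win_often : p * (#|{: mats}|%:R * #|Theta|%:R) <= #|Win|%:R.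

Let p0 := p * (7 / 8) ^+ u.
Let p0_gt0 : 0 < p0. Proof. by rewrite mulr_gt0 // exprn_gt0 // divr_gt0. Qed.

Definition wins U A th := [exists t : 'I_m.+1, good U (Enc A) A th t].

(* [bin_ratio]: a random set of [u] rows avoids the at most [m] queried ones
   with probability at least (7/8)^u. *)
Lemma ex_unqueried_rows : exists2 U : {set 'I_n}, #|U| = u &
  p0 * (#|{: mats}|%:R * #|Theta|%:R) <= #|[pred x : mats * Theta | wins U x.1 x.2]|%:R.
Proof.
apply: contrapT => hn.
have {}hn U : #|U| = u ->
    #|[pred x : mats * Theta | wins U x.1 x.2]|%:R < p0 * (#|{: mats}|%:R * #|Theta|%:R).
  by move=> hU; rewrite ltNge; apply/negP => le; apply: hn; exists U.
have un : (u <= n)%N.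
  exact: leq_trans (leq_pmull u (ltn0Sn 7)) (leq_trans (leq_addl _ _) n_large).
pose D := [set U : {set 'I_n} | #|U| == u]%SET.
have cD : #|D| = 'C(n, u) by rewrite card_draws card_ord.
have Cpos : (0 < 'C(n, u))%N by rewrite bin_gt0.
have lt1 : \sum_(U in D) #|[pred x : mats * Theta | wins U x.1 x.2]|%:R <
    'C(n, u)%:R * (p0 * (#|{: mats}|%:R * #|Theta|%:R)) :> R.
  rewrite -cD mulr_natl -sumr_const; apply: ltr_sum.
    have /card_gt0P[U UD] : (0 < #|D|)%N by rewrite cD.
    by apply/hasP; exists U; rewrite ?mem_index_enum.
  by move=> U; rewrite inE => /eqP; exact: hn.
have le1 : #|Win|%:R * 'C(n - m, u)%:R <=
    \sum_(U in D) #|[pred x : mats * Theta | wins U x.1 x.2]|%:R :> R.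
  rewrite -natr_sum -natrM ler_nat.
  under eq_bigr do rewrite -sum1_card big_mkcond /=.
  rewrite exchange_big /= -sum_nat_const big_mkcond /=.
  apply: leq_sum => -[A th] _; case: ifP => // W.
  have [t tm [Q Qm hQ]] := WinP W.
  (* Every [u]-subset of the complement of [Q] may serve as the set of hidden rows. *)
  apply: (@leq_trans #|[set U : {set 'I_n} | U \subset ~: Q & #|U| == u]%SET|).
    rewrite cards_draws; apply: leq_bin2l.
    by rewrite cardsCs finset.setCK card_ord leq_sub2l.
  rewrite -sum1_card big_mkcond [leqRHS]big_mkcond /=; apply: leq_sum => U _.
  rewrite !inE; case: ifP => // /andP[UQ ->].
  suff -> : wins U A th by [].
  apply/existsP; exists (inord t); rewrite inordK ?ltnS //.
  exact: hQ.
have Cle := bin_ratio n_large.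
have {}Cle : (7 / 8) ^+ u * 'C(n, u)%:R <= 'C(n - m, u)%:R :> R.
  rewrite exprMn exprVn mulrAC ler_pdivrMr ?exprn_gt0 // [leRHS]mulrC.
  by rewrite -!natrX -!natrM ler_nat.
have X0 : 0 <= (#|{: mats}|%:R * #|Theta|%:R : R) by rewrite mulr_ge0.
have le2 : 'C(n, u)%:R * (p0 * (#|{: mats}|%:R * #|Theta|%:R)) <=
    #|Win|%:R * 'C(n - m, u)%:R :> R.
  apply: le_trans (ler_wpM2r (ler0n _ _) Win_often).
  have := ler_wpM2l (mulr_ge0 (ltW p_gt0) X0) Cle; rewrite /p0; nra.
by have := lt_le_trans lt1 (le_trans le2 le1); rewrite ltxx.
Qed.

Hypothesis Theta_gt0 : (0 < #|Theta|)%N.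

(** A hidden vector with a winning query either has one near the span of the previous points, which
    is rare by [card_near_span_le], or its query extends the tuple. *)
Lemma card_valid_extend U M A s : (size s < K)%N -> valid U M A s ->
  #|[pred th | [exists t : 'I_m.+1, good U M A th t]]|%:R <=
  qc * #|Theta|%:R + #|[pred xi | valid U M A (xi :: s)]|%:R :> R.
Proof.
move=> sK sv; pose y l := nth 0 (map (pt U M A) (rev s)) l.
have yE xi l : (l < size s)%N -> y l = pt U M A (nth xi (rev s) l).
  by move=> ls; rewrite /y (nth_map xi) // size_rev.
apply: le_trans (lerD (card_near_span_le U M A y (ltnW sK)) (lexx _)).
set B := [pred th | `[< _ >]]; pose V := [pred xi | valid U M A (xi :: s)].
apply: (@le_trans _ _ (#|B|%:R + #|[set fst xi | xi in V]%SET|%:R)); last first.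
  by rewrite lerD2l ler_nat leq_imset_card.
rewrite -natrD ler_nat -cardUI; apply: leq_trans (leq_addr _ _).
apply: subset_leq_card; apply/fintype.subsetP => th; rewrite inE => /existsP[t gt].
have [thB|nB] := pselect (exists2 t : nat, good U M A th t & exists c : nat -> R,
      normv (Y U M A th t - \sum_(l < size s) c l *: y l) < rho).
  by rewrite !inE; apply/orP; left; apply/asboolP.
rewrite !inE; apply/orP; right; apply/imsetP; exists (th, t) => //.
rewrite unfold_in /= gt sv andbT /=; apply/asboolP => c.
rewrite leNgt; apply/negP => lt1; apply: nB; exists t => //; exists c.
by under eq_bigr => l _ do rewrite (yE (th, t)) //.
Qed.

(* Double counting of the pairs of [A] and a valid [K]-tuple: if [A] wins for
   many hidden vectors then the tuple can be built greedily, while for a fixed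
   tuple and a fixed memory state few [A] are possible by [card_valid]. *)
Lemma game_bound : 4 * qc <= p0 ->
  p0 / 2 * (p0 / 4) ^+ K * 2 ^+ (h * u) <= #|Mem|%:R * m.+1%:R ^+ K.
Proof.
move=> qp0; have [U Uu hU] := ex_unqueried_rows.
set X : R := #|{: mats}|%:R in hU *; set Th : R := #|Theta|%:R in hU *.
have Th0 : 0 < Th by rewrite ltr0n.
have X0 : 0 < X by rewrite ltr0n card_ffun card_signs !expn_gt0.
(* By averaging, at least a [p0 / 2] fraction of the matrices win against a [p0 / 2] fraction of the
   hidden vectors. *)
pose G := [pred A | p0 / 2 * Th <= #|[pred th | wins U A th]|%:R].
have G_often : p0 / 2 * X <= #|G|%:R.
  have le1 : p0 * (X * Th) <= \sum_(A : mats) #|[pred th | wins U A th]|%:R.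
    apply: le_trans hU _; rewrite -natr_sum ler_nat -sum1_card big_mkcond /=.
    under [leqRHS]eq_bigr do rewrite -sum1_card big_mkcond /=.
    by rewrite pair_big /= leq_eqVlt; apply/orP; left; apply/eqP/eq_bigr => -[A th] _.
  have le2 : \sum_(A : mats) #|[pred th | wins U A th]|%:R <=
      #|G|%:R * Th + X * (p0 / 2 * Th).
    have -> : #|G|%:R * Th = \sum_(A in G) Th by rewrite sumr_const mulr_natl.
    have -> : X * (p0 / 2 * Th) = \sum_(A : mats) (p0 / 2 * Th).
      by rewrite sumr_const -[RHS]mulr_natl.
    rewrite [Y in Y + _]big_mkcond /= -big_split /=; apply: ler_sum => A _.
    case: ifPn => GA; first by rewrite ler_wpDr ?ler_nat ?max_card // mulr_ge0 ?divr_ge0 ?(ltW p0_gt0) ?(ltW Th0).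
    by rewrite add0r ltW // ltNge.
  rewrite -(ler_pM2r Th0); lra.
(* Each extension has at least [(p0 / 2 - qc) * Th] choices, and [qc <= p0 / 4]. *)
have tuples A : A \in G ->
    (p0 / 4 * Th) ^+ K <= #|[pred t : K.-tuple _ | valid U (Enc A) A t]|%:R.
  rewrite inE => GA; apply: card_tuples_ge => //.
  - by rewrite mulr_ge0 ?divr_ge0 ?(ltW p0_gt0) ?(ltW Th0).
  - by move=> xi s /= /and3P[].
  move=> s sK sv; have le1 := card_valid_extend sK sv.
  have := le_trans GA le1; rewrite -/Th.
  have := ler_wpM2r (ltW Th0) qp0; lra.
have lower : p0 / 2 * X * (p0 / 4 * Th) ^+ K <=
    \sum_(A : mats) #|[pred t : K.-tuple _ | valid U (Enc A) A t]|%:R.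
  apply: (@le_trans _ _ (#|G|%:R * (p0 / 4 * Th) ^+ K)).
    by rewrite ler_wpM2r // exprn_ge0 // mulr_ge0 ?divr_ge0 ?(ltW p0_gt0) ?(ltW Th0).
  rewrite mulr_natl -sumr_const big_mkcond /=; apply: ler_sum => A _.
  by case: ifP => // /tuples.
(* Summing over all memory states in place of [Enc A] decouples the state from [A], so that
   [card_valid] applies; the price is the factor [#|Mem|]. *)
have upper : \sum_(A : mats) #|[pred t : K.-tuple _ | valid U (Enc A) A t]|%:R <=
    #|Mem|%:R * (Th * m.+1%:R) ^+ K * ((2 ^+ (h * u))^-1 * X).
  apply: (@le_trans _ _ (\sum_(M : Mem) \sum_(t : K.-tuple (Theta * 'I_m.+1))
      #|[pred A | valid U M A t]|%:R)); last first.
    apply: (@le_trans _ _ (\sum_(M : Mem) \sum_(t : K.-tuple (Theta * 'I_m.+1))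
        (2 ^+ (h * u))^-1 * X)).
      by apply: ler_sum => M _; apply: ler_sum => t _; rewrite -Uu; exact: card_valid.
    rewrite !sumr_const card_tuple card_prod card_ord -mulrnA -[leLHS]mulr_natl.
    by rewrite natrM natrX natrM mulrC [in leLHS](mulrC _ #|Mem|%:R) mulrC.
  rewrite -!natr_sum.
  under [leRHS]eq_bigr => M _ do rewrite -natr_sum.
  rewrite -natr_sum ler_nat.
  have cardE (T : finType) (P : pred T) : #|[pred x | P x]| = (\sum_x (P x : nat))%N.
    by rewrite -sum1_card big_mkcond.
  under eq_bigr do rewrite cardE.
  under [leqRHS]eq_bigr => M _ do under eq_bigr do rewrite cardE.
  under [leqRHS]eq_bigr do rewrite exchange_big /=.
  rewrite [leqRHS]exchange_big /=; apply: leq_sum => A _.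
  by rewrite (bigD1 (Enc A)) //= leq_addr.
have := le_trans lower upper.
have -> : (p0 / 4 * Th) ^+ K = (p0 / 4) ^+ K * Th ^+ K by rewrite exprMn.
have -> : (Th * m.+1%:R) ^+ K = Th ^+ K * m.+1%:R ^+ K by rewrite exprMn.
set e := 2 ^+ (h * u); set P := (p0 / 4) ^+ K; set Q := m.+1%:R ^+ K.
have e0 : 0 < e by rewrite exprn_gt0.
set ThK := Th ^+ K; have ThK0 : 0 < ThK by rewrite exprn_gt0.
have c0 : 0 < X * ThK / e by rewrite divr_gt0 // mulr_gt0.
move=> H; rewrite -(ler_pM2r c0).
have -> : p0 / 2 * P * e * (X * ThK / e) = p0 / 2 * X * (P * ThK).
  by field; rewrite gt_eqF.
have -> : #|Mem|%:R * Q * (X * ThK / e) = #|Mem|%:R * (ThK * Q) * (e^-1 * X).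
  by field; rewrite gt_eqF.
exact: H.
Qed.

End Game.

(** * Oracles of maxima of affine functions *)

Section PiecewiseLinear.
Variables (R : realType) (d : nat) (I : finType) (i0 : I) (s : R).
Implicit Types (c : I -> 'rV[R]_d) (b : I -> R) (P : pred I) (x y : 'rV[R]_d).

Definition lin c b i x := dotv (c i) x + b i.

(* Taking the first maximizer in a fixed enumeration makes the choice stable
   under removal of pieces that are not selected. *)
Definition best c b P x : I :=
  head i0 [seq i <- enum I | P i && [forall j, P j ==> (lin c b j x <= lin c b i x)]].

Lemma best_cons c b P x : (exists i, P i) -> exists l,
  [seq i <- enum I | P i && [forall j, P j ==> (lin c b j x <= lin c b i x)]]
    = best c b P x :: l.
Proof.
move=> [i1 Pi1]; rewrite /best; set l := [seq i <- _ | _].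
have : [arg max_(i > i1 | P i) lin c b i x]%O \in l.
  case: arg_maxP => // i Pi hi; rewrite mem_filter mem_enum andbT Pi /=.
  by apply/forall_inP => j Pj; exact: hi.
by case: l => // a l _; exists l.
Qed.

Lemma bestP c b P x : (exists i, P i) ->
  P (best c b P x) /\ forall j, P j -> lin c b j x <= lin c b (best c b P x) x.
Proof.
move=> hP; have [l hl] := best_cons c b x hP.
have : best c b P x \in best c b P x :: l by rewrite mem_head.
rewrite -hl mem_filter => /andP[/andP[Pb /forall_inP hb] _].
by split.
Qed.

(** The maximum over [P] is attained inside [P'], so the maximizers in [P'] are those in [P] that
    lie in [P'], and filtering keeps the head. *)
Lemma best_sub c b P P' x : (forall i, P' i -> P i) -> P' (best c b P x) ->
  best c b P' x = best c b P x.
Proof.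
move=> PP' P'b; have hP : exists i, P i by exists (best c b P x); exact: PP'.
have [l hl] := best_cons c b x hP; have [Pb hb] := bestP c b x hP.
rewrite {1}/best; set l' := [seq i <- _ | _].
suff -> : l' = [seq i <- best c b P x :: l | P' i] by rewrite /= P'b.
rewrite -hl -filter_predI; apply: eq_filter => i /=.
have [P'i|//] := boolP (P' i); rewrite PP' //=.
apply/forall_inP/forall_inP => h j Pj; last by apply: h; exact: PP'.
by apply: le_trans (hb _ Pj) (h _ P'b).
Qed.

Lemma eq_best c b c' b' P x : (forall i, P i -> c i = c' i /\ b i = b' i) ->
  best c b P x = best c' b' P x.
Proof.
move=> h; rewrite /best; congr head; apply: eq_filter => i.
have [Pi|//] := boolP (P i) => /=.
have e j : P j -> lin c b j x = lin c' b' j x.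
  by move=> /h[cj bj]; rewrite /lin cj bj.
by apply/forall_inP/forall_inP => hh j Pj; [rewrite -!e|rewrite !e] => //; exact: hh.
Qed.

Definition pwlF c b P x := s * lin c b (best c b P x) x.
Definition pwlG c b P x := s *: c (best c b P x).

Hypothesis s_ge0 : 0 <= s.

Lemma pwl_subgradient_ge c b P x y : (exists i, P i) ->
  pwlF c b P x + dotv (pwlG c b P x) (y - x) <= pwlF c b P y.
Proof.
move=> hP; have [Pb _] := bestP c b x hP; have [_ hb] := bestP c b y hP.
apply: le_trans (ler_wpM2l s_ge0 (hb _ Pb)).
rewrite /pwlG /pwlF /lin dotvZl dotvBr -mulrDr ler_wpM2l //; lra.
Qed.

Lemma pwl_lipschitz c b P : (exists i, P i) ->
  (forall i, P i -> s * normv (c i) <= 1) -> lipschitz1_ball (pwlF c b P).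
Proof.
move=> hP hc x y _ _.
have half u v : pwlF c b P u - pwlF c b P v <= normv (u - v).
  have h1 := pwl_subgradient_ge c b u v hP; have [Pb _] := bestP c b u hP.
  have h2 := ler_dotv (pwlG c b P u) (u - v).
  have h3 := ler_norm (dotv (pwlG c b P u) (u - v)).
  have hg : normv (pwlG c b P u) <= 1 by rewrite normvZ ger0_norm // hc.
  have h4 := ler_wpM2r (normv_ge0 (u - v)) hg.
  have e : v - u = - (u - v) by rewrite opprB.
  rewrite e dotvNr in h1; lra.
rewrite ler_norml; apply/andP; split; last exact: half.
have := half y x; have -> : y - x = - (x - y) by rewrite opprB.
rewrite normvN; lra.
Qed.

(** Combining the two subgradient inequalities at the intermediate point [z] cancels the linear
    terms. *)
Lemma pwl_convex c b P : (exists i, P i) -> convex_ball (pwlF c b P).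
Proof.
move=> hP x y l _ _ l0 l1; set z := l *: x + _.
have hx := pwl_subgradient_ge c b z x hP.
have hy := pwl_subgradient_ge c b z y hP.
have l1' : 0 <= 1 - l by lra.
have := lerD (ler_wpM2l l0 hx) (ler_wpM2l l1' hy).
apply: le_trans; set g := pwlG c b P z.
have -> : l * (pwlF c b P z + dotv g (x - z)) + (1 - l) * (pwlF c b P z + dotv g (y - z))
  = pwlF c b P z + (dotv g (l *: (x - z) + (1 - l) *: (y - z))).
  by rewrite (dotvDr (l *: (x - z))) !dotvZr; ring.
rewrite -[leLHS]addr0 lerD2l.
have -> : l *: (x - z) + (1 - l) *: (y - z) = 0.
  rewrite !scalerBr addrACA -opprD -scalerDl (addrC l) subrK scale1r.
  by rewrite /z subrr.
by rewrite dotv0r.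
Qed.

Lemma pwl_subgradient c b P : (exists i, P i) ->
  is_subgradient_oracle (pwlF c b P) (pwlG c b P).
Proof. by move=> hP x _ y _; exact: pwl_subgradient_ge. Qed.

Section Runs.
Variables (S : nat) (A : det_alg R d S).
Implicit Types (M : {ffun 'I_S -> bool}).

Definition run c b P M t := iter t (alg_step A (pwlF c b P) (pwlG c b P)) M.

Lemma runD c b P M t t' : run c b P M (t + t') = run c b P (run c b P M t) t'.
Proof. by rewrite /run addnC iterD. Qed.

(** An oracle knowing only [P'] simulates the run as long as the true answers lie in [P']. *)
Lemma run_sub c b P P' M t : (forall i, P' i -> P i) ->
  (forall t', (t' < t)%N -> P' (best c b P (query A (run c b P M t')))) ->
  run c b P' M t = run c b P M t.
Proof.
move=> PP'; elim: t => // t IH h; rewrite /run !iterS -!/(run _ _ _ _ t).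
rewrite IH => [|t' t't]; last by apply: h; exact: ltnW.
by rewrite /alg_step /pwlF /pwlG (best_sub PP') //; exact: h.
Qed.

Lemma eq_run c b c' b' P M t : (exists i, P i) ->
  (forall i, P i -> c i = c' i /\ b i = b' i) ->
  run c b P M t = run c' b' P M t.
Proof.
move=> hP h; elim: t => // t IH; rewrite /run !iterS -!/(run _ _ _ _ t) IH.
rewrite /alg_step /pwlF /pwlG (eq_best _ h).
set x := query A _; have [Pb _] := bestP c' b' x hP.
by have [cb bb] := h _ Pb; rewrite /lin cb bb.
Qed.

End Runs.
End PiecewiseLinear.

Lemma card_pred_pair (T1 T2 : finType) (P : pred (T1 * T2)) :
  #|P| = (\sum_(x : T1) #|[pred y | P (x, y)]|)%N.
Proof.
rewrite -sum1_card big_mkcond /=.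
under [RHS]eq_bigr do rewrite -sum1_card big_mkcond /=.
by rewrite pair_big /=; apply: eq_bigr => -[x y].
Qed.

Lemma card_pair_le (R : numDomainType) (T1 T2 : finType) (P : pred (T1 * T2)) (q : R) :
  (forall x, #|[pred y | P (x, y)]|%:R <= q * #|T2|%:R) ->
  #|P|%:R <= q * (#|T1|%:R * #|T2|%:R).
Proof.
move=> h; rewrite card_pred_pair natr_sum.
apply: le_trans (ler_sum _ (fun x _ => h x)) _.
by rewrite sumr_const -[leLHS]mulr_natl mulrCA.
Qed.

(** * The hard instances *)

Section Instances.
Variables (R : realType) (d n N : nat) (Lam gam : R).
Notation mats := {ffun 'I_n -> signs d}.
Notation vecs := {ffun 'I_N -> signs d}.
Notation piece := ('I_n * bool + 'I_N)%type.

(** The two values of [e] split the absolute value of a wall into two affine pieces. *)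
Definition slope (A : mats) (V : vecs) (i : piece) : 'rV[R]_d :=
  match i with
  | inl (j, e) => (Lam * (-1) ^+ e) *: vec R (A j)
  | inr i => (Num.sqrt d%:R)^-1 *: vec R (V i)
  end.

Definition offset (i : piece) : R :=
  match i with inl _ => -1 | inr i => - (i%:R * gam) end.

Hypotheses (d_gt0 : (0 < d)%N) (N_gt0 : (0 < N)%N).

Let sd : R := Num.sqrt d%:R.
Let sd_gt0 : 0 < sd. Proof. by rewrite sqrtr_gt0 ltr0n. Qed.
Let sd2 : sd ^+ 2 = d%:R. Proof. by rewrite sqr_sqrtr. Qed.

Definition piece0 : piece := inr (Ordinal N_gt0).

(** For [gam] the inverse of 4 N sqrt N, as chosen below, the last bound divided by sqrt d is
    [- N * gam]. *)
Definition solvable (A : mats) (V : vecs) := exists2 y : 'rV[R]_d, in_ball y &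
  (forall j, dotv (vec R (A j)) y = 0) /\
  (forall i, dotv (vec R (V i)) y <= - (sd / (4 * Num.sqrt N%:R))).

(* The witness is the normalized sum of the projections of the hidden vectors
   on the kernel of [A]. *)
Lemma solvable_of_spread (A : mats) (V : vecs) q : orthosys n q ->
  (forall j : 'I_n, vec R (A j) = \sum_(l < n) dotv (vec R (A j)) (q l) *: q l) ->
  (forall i, \sum_(l < n) dotv (vec R (V i)) (q l) ^+ 2 <= d%:R / 4) ->
  (forall i j, i != j -> `|dotv (vec R (V i))
     (vec R (V j) - \sum_(l < n) dotv (vec R (V j)) (q l) *: q l)| <= d%:R / (4 * N%:R)) ->
  solvable A V.
Proof.
move=> oq hA hd ho.
pose w j := vec R (V j) - \sum_(l < n) dotv (vec R (V j)) (q l) *: q l.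
have N0 : 0 < (N%:R : R) by rewrite ltr0n.
set sN := Num.sqrt (N%:R : R).
have sN0 : 0 < sN by rewrite sqrtr_gt0.
have sN2 : sN ^+ 2 = N%:R by rewrite sqr_sqrtr // ltW.
have wq j (l : 'I_n) : dotv (w j) (q l) = 0.
  rewrite dotvBl (orthosys_dotl (fun l => dotv (vec R (V j)) (q l)) l) //.
  case: (oq) => _ /(_ _ (ltn_ord l))[/dotvv_eq0 ->|->].
    by rewrite dotv0r mul0r subrr.
  by rewrite mulr1 subrr.
have ww i j : dotv (w i) (w j) = dotv (vec R (V i)) (w j).
  rewrite /w dotvBl -/(w j) dotv_suml big1 ?subr0 // => l _.
  by rewrite dotvZl (dotvC (q l)) wq mulr0.
have wdiag i : dotv (vec R (V i)) (w i) = d%:R - \sum_(l < n) dotv (vec R (V i)) (q l) ^+ 2.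
  rewrite /w dotvBr dotv_vec dotv_sumr; congr (_ - _).
  by apply: eq_bigr => l _; rewrite dotvZr expr2.
have offsum i : `|\sum_(j | j != i) dotv (vec R (V i)) (w j)| <= d%:R / 4.
  apply: le_trans (ler_norm_sum _ _ _) _.
  apply: (@le_trans _ _ (\sum_(j < N) d%:R / (4 * N%:R))); last first.
    rewrite sumr_const card_ord -[leLHS]mulr_natl le_eqVlt; apply/orP; left.
    by apply/eqP; field; rewrite gt_eqF.
  rewrite big_mkcond /=; apply: ler_sum => j _; case: ifPn => ji.
    by apply: ho; rewrite eq_sym.
  by rewrite divr_ge0 // ltW // mulr_gt0.
(* The Gram matrix of the projections is diagonally dominant: diagonal between 3d/4 and d, the rest
   of a row at most d/4. *)
have rowsum i : d%:R / 2 <= dotv (vec R (V i)) (\sum_j w j) <= 5 / 4 * d%:R.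
  rewrite dotv_sumr (bigD1 i) //= wdiag.
  have := offsum i; rewrite ler_norml => /andP[].
  have := hd i.
  have : 0 <= \sum_(l < n) dotv (vec R (V i)) (q l) ^+ 2.
    by apply: sumr_ge0 => l _; exact: sqr_ge0.
  set a := \sum_(l < n) _; set b := \sum_(j | _) _ => *; apply/andP; split; lra.
(* With this scale the squared norm of the witness is at most 5/16, while each inner product is at
   most [- k * d / 2], the required bound. *)
pose k := (2 * sN * sd)^-1.
have k0 : 0 < k by rewrite invr_gt0 !mulr_gt0.
exists (- k *: \sum_j w j).
  rewrite /in_ball normv_le ?ler01 // expr1n dotvZl dotvZr mulrA mulrNN.
  have : dotv (\sum_j w j) (\sum_j w j) <= N%:R * (5 / 4 * d%:R).
    have -> : N%:R * (5 / 4 * d%:R) = \sum_(i < N) (5 / 4 * d%:R) :> R.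
      by rewrite sumr_const card_ord mulr_natl.
    rewrite dotv_suml; apply: ler_sum => i _; rewrite dotv_sumr.
    under eq_bigr do rewrite ww; rewrite -dotv_sumr.
    by have /andP[] := rowsum i.
  have k2 : k * k * (N%:R * d%:R) = 1 / 4.
    by rewrite /k -sN2 -sd2; field; rewrite !gt_eqF.
  set D := dotv _ _ => hD.
  have kk0 : 0 <= k * k by rewrite mulr_ge0 // ltW.
  have := ler_wpM2l kk0 hD; lra.
split=> [j|i].
  rewrite dotvZr dotv_sumr big1 ?mulr0 // => i _.
  rewrite hA dotv_suml big1 // => l _.
  by rewrite dotvZl (dotvC (q l)) wq mulr0.
rewrite dotvZr mulNr lerN2.
have -> : sd / (4 * sN) = k * (d%:R / 2).
  by rewrite /k -sd2; field; rewrite !gt_eqF.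
by rewrite ler_wpM2l ?(ltW k0) //; have /andP[] := rowsum i.
Qed.

(** Union bound over two failures: some hidden vector has a large projection on the row span
    ([span_tail] at half of sqrt d), or some pair is correlated after projection ([sign_tail_norm]
    at d / (4 N)). *)
Lemma card_unsolvable (A : mats) :
  #|[pred V : vecs | ~~ `[< solvable A V >]]|%:R <=
  (N%:R * ((4 * n + 2)%:R ^+ n * expR (- (d%:R / 128))) +
   N%:R ^+ 2 * (2 * expR (- (d%:R / (128 * N%:R ^+ 2))))) * #|{: vecs}|%:R :> R.
Proof.
pose a j : 'rV[R]_d := if insub j is Some j' then vec R (A j') else 0.
have [q oq hq] := gram_schmidt n a.
have hA (j : 'I_n) : vec R (A j) = \sum_(l < n) dotv (vec R (A j)) (q l) *: q l.
  by have := hq j (ltn_ord j); rewrite /a valK.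
pose pr j (V : vecs) := vec R (V j) - \sum_(l < n) dotv (vec R (V j)) (q l) *: q l.
have d0 : 0 < (d%:R : R) by rewrite ltr0n.
have N0 : 0 < (N%:R : R) by rewrite ltr0n.
pose E (z : 'I_N + 'I_N * 'I_N) : pred vecs := match z with
  | inl i => [pred V : vecs | (sd / 2) ^+ 2 <= \sum_(l < n) dotv (vec R (V i)) (q l) ^+ 2]
  | inr (i, j) => [pred V : vecs | (i != j) && (d%:R / (4 * N%:R) <= `|dotv (vec R (V i)) (pr j V)|)]
  end.
apply: (le_trans (card_union_bound R (Q := E) _)).
  move=> V /= /asboolPn nsol; apply: contrapT => /forallNP hE; apply: nsol.
  have sd4 : (sd / 2) ^+ 2 = d%:R / 4 by rewrite exprMn sd2 exprVn -natrX.
  apply: (solvable_of_spread oq hA) => [i|i j ij].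
    by have := hE (inl i); rewrite /E /= sd4 => /negP; rewrite -ltNge => /ltW.
  by have := hE (inr (i, j)); rewrite /E /= ij /= => /negP; rewrite -ltNge => /ltW.
rewrite big_sumType /=.
rewrite [leRHS]mulrDl.
apply: lerD.
  rewrite -mulrA; set X := (X in _ <= _ * X).
  have -> : N%:R * X = \sum_(i < N) X by rewrite sumr_const card_ord mulr_natl.
  apply: ler_sum => i _.
  apply: (card_marginal i (Q := fun r => (sd / 2) ^+ 2 <= \sum_(l < n) dotv (vec R r) (q l) ^+ 2)).
  have sd20 : 0 < sd / 2 by rewrite divr_gt0.
  apply: le_trans (span_tail oq sd20) _.
  rewrite card_signs natrX -[leRHS]mulrA ler_wpM2l ?exprn_ge0 // mulrC ler_wpM2r ?exprn_ge0 //.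
  rewrite ler_expR lerN2 exprMn sd2 exprVn le_eqVlt; apply/orP; left; apply/eqP; lra.
rewrite -mulrA.
set X := (X in _ <= _ * X).
have -> : N%:R ^+ 2 * X = \sum_(z : 'I_N * 'I_N) X.
  by rewrite sumr_const card_prod !card_ord -[RHS]mulr_natl natrM expr2.
apply: ler_sum => -[i j] _ /=; rewrite {}/X.
have [ij|ij] := eqVneq i j.
  by rewrite (_ : #|_| = 0%N) ?mulr_ge0 ?expR_ge0 //; apply: eq_card0.
(* Only the [i]-th vector is redrawn; the projected [j]-th one stays fixed. *)
apply: (card_mix_le (L := [set i]%SET)) => V.
have prV W : pr j (mix [set i]%SET V W) = pr j V.
  by rewrite /pr mixE inE eq_sym (negbTE ij).
pose Q r := d%:R / (4 * N%:R) <= `|dotv (vec R r) (pr j V)|.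
rewrite (eq_card (B := [pred W : vecs | Q (W i)])); last first.
  by move=> W; rewrite !inE /= prV mixE inE eqxx.
apply: card_marginal.
have prn : dotv (pr j V) (pr j V) <= d%:R.
  rewrite -(dotv_vec R (V j)).
  set v := vec R (V j); rewrite /pr -/v; set t := \sum_(l < n) _.
  have vt : dotv v t = \sum_(l < n) dotv v (q l) ^+ 2.
    by rewrite dotv_sumr; apply: eq_bigr => l _; rewrite dotvZr expr2.
  have tt := orthosys_sqnorm (c := fun l => dotv v (q l)) oq (erefl t).
  rewrite dotvBl !dotvBr (dotvC t v) vt.
  have : 0 <= \sum_(l < n) dotv v (q l) ^+ 2.
    by apply: sumr_ge0 => l _; exact: sqr_ge0.
  move: tt => /=; lra.
have s0 : 0 <= d%:R / (4 * N%:R) :> R by rewrite divr_ge0 // mulr_ge0.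
apply: le_trans (sign_tail_norm d0 prn s0) _.
rewrite card_signs natrX mulrA [leRHS]mulrAC ler_wpM2l ?mulr_ge0 ?exprn_ge0 //.
rewrite ler_expR lerN2 le_eqVlt; apply/orP; left; apply/eqP.
by field; rewrite !gt_eqF.
Qed.

End Instances.

(** * Phases of a run *)

Section Phases.
Variables (R : realType) (d n N S T : nat) (Lam gam s : R) (alg : det_alg R d S).
Notation mats := {ffun 'I_n -> signs d}.
Notation vecs := {ffun 'I_N -> signs d}.
Notation piece := ('I_n * bool + 'I_N)%type.
Implicit Types (A : mats) (V W : vecs) (U : {set 'I_n}) (i : nat).

Hypotheses (d_gt0 : (0 < d)%N) (n_gt0 : (0 < n)%N) (N_gt1 : (1 < N)%N).
Let N_gt0 : (0 < N)%N. Proof. exact: ltnW. Qed.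
Hypotheses (Lam_gt0 : 0 < Lam) (s_gt0 : 0 < s).
Hypothesis gamE : gam = (4 * (N%:R * Num.sqrt N%:R))^-1.

Let i0 : piece := piece0 n N_gt0.
Let sd : R := Num.sqrt d%:R.
Let sd_gt0 : 0 < sd. Proof. by rewrite sqrtr_gt0 ltr0n. Qed.
(** A quarter of the gap between consecutive offsets, on the scale of [dotv v x]: noise of this size
    cannot close the gap. *)
Let beta := gam * sd / 4.

Let N0 : 0 < (N%:R : R). Proof. by rewrite ltr0n. Qed.
Let sN0 : 0 < Num.sqrt (N%:R : R). Proof. by rewrite sqrtr_gt0. Qed.
Let gam_gt0 : 0 < gam. Proof. by rewrite gamE invr_gt0 !mulr_gt0. Qed.
Let gam_le1 : gam <= 1.
Proof.
have sN1 : 1 <= Num.sqrt (N%:R : R).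
  have : Num.sqrt 1 <= Num.sqrt (N%:R : R) by rewrite ler_wsqrtr // ler1n.
  by rewrite sqrtr1.
have N1 : 1 <= (N%:R : R) by rewrite ler1n.
rewrite gamE invf_le1 ?mulr_gt0 //; nra.
Qed.
Let beta_gt0 : 0 < beta. Proof. by rewrite divr_gt0 // mulr_gt0. Qed.

(** The oracle that has all walls but only the first [i] hidden vectors. *)
Definition early i : pred piece :=
  fun z => match z with inl _ => true | inr l => (l < i)%N end.

(** As [early], with the walls of the rows in [U] also withheld; this oracle replays a phase in the
    memory game. *)
Definition outside U i : pred piece :=
  fun z => match z with inl (j, _) => j \notin U | inr l => (l < i)%N end.

Definition bst A V x := best i0 (slope Lam A V) (offset gam) xpredT x.
Definition prun A V P M t := run i0 s alg (slope Lam A V) (offset gam) P M t.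
Definition traj A V t := prun A V xpredT (mem0 alg) t.
Definition qry A V t := query alg (traj A V t).

Definition reveals i A V t : bool :=
  if bst A V (qry A V t) is inr l then (i <= l)%N else false.

(* First time at which a hidden vector of index at least [i] is revealed;
   [T.-1] if there is none. *)
Definition hit A V i := find (reveals i A V) (iota 0 T.-1).

Lemma ex_early i : exists z, early i z.
Proof. by exists (inl (Ordinal n_gt0, true)). Qed.

Lemma hit_le A V i : (hit A V i <= T.-1)%N.
Proof. by rewrite -[leqRHS](size_iota 0) find_size. Qed.

Lemma before_hit A V i t : (t < hit A V i)%N -> ~~ reveals i A V t.
Proof.
move=> th; have := before_find 0%N th.
by rewrite nth_iota ?add0n ?(leq_trans th) ?hit_le // => ->.
Qed.

Lemma reveals_hit A V i : (hit A V i < T.-1)%N -> reveals i A V (hit A V i).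
Proof.
move=> h; have : has (reveals i A V) (iota 0 T.-1) by rewrite has_find size_iota.
by move/(nth_find 0%N); rewrite nth_iota.
Qed.

Lemma reveals_early A V i t : ~~ reveals i A V t -> early i (bst A V (qry A V t)).
Proof. by rewrite /reveals; case: bst => //= l; rewrite ltnNge. Qed.

Lemma hit_mono A V i i' : (i <= i')%N -> (hit A V i <= hit A V i')%N.
Proof.
move=> ii'; apply: sub_find => t; rewrite /reveals; case: bst => // l.
exact: leq_trans.
Qed.

Lemma traj_early A V i t : (t <= hit A V i)%N ->
  prun A V (early i) (mem0 alg) t = traj A V t.
Proof.
move=> th; apply: run_sub => // t' t't.
by apply: reveals_early; apply: before_hit; exact: leq_trans th.
Qed.

Lemma eq_prun_early A V V' i M t : (forall l : 'I_N, (l < i)%N -> V l = V' l) ->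
  prun A V (early i) M t = prun A V' (early i) M t.
Proof.
move=> h; apply: eq_run; first exact: ex_early.
by move=> [[j e]|l] //= li; rewrite h.
Qed.

(* The run seeing only hidden vectors of index below [i] is independent of the
   later ones, and coincides with the true run up to [hit A V i]. *)
Definition quiet A V : bool := [forall l : 'I_N, forall i : 'I_N, (i <= l)%N ==>
  [forall t : 'I_T.+1,
    (`|dotv (vec R (V l)) (query alg (prun A V (early i) (mem0 alg) t))| <= beta) &&
    (`|dotv (vec R (V l)) (output alg (prun A V (early i) (mem0 alg) t))| <= beta)]].

Lemma quietP A V (l : 'I_N) i t : quiet A V -> (i <= l)%N -> (t <= hit A V i)%N ->
  `|dotv (vec R (V l)) (qry A V t)| <= beta /\
  `|dotv (vec R (V l)) (output alg (traj A V t))| <= beta.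
Proof.
move=> /forallP/(_ l)/forallP h il th.
have iN : (i < N)%N by exact: leq_ltn_trans il _.
have := h (Ordinal iN); rewrite /= il /= => /forallP h'.
have tT : (t < T.+1)%N.
  by rewrite ltnS (leq_trans th) // (leq_trans (hit_le _ _ _)) // leq_pred.
by have := h' (Ordinal tT); rewrite /= traj_early // => /andP.
Qed.

(** For [i <= l] the run that sees only vectors of index below [i] ignores the [l]-th one, which can
    be redrawn; then [sign_tail_norm] at [beta] and a union bound over indices, times, queries and
    outputs. *)
Lemma card_noisy : #|[pred x : mats * vecs | ~~ quiet x.1 x.2]|%:R <=
  4 * N%:R ^+ 2 * T.+1%:R * expR (- (gam ^+ 2 * d%:R / 128)) *
  (#|{: mats}|%:R * #|{: vecs}|%:R) :> R.
Proof.
apply: card_pair_le => A.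
pose X (k : bool) V i t := (if k then query alg else output alg)
  (prun A V (early i) (mem0 alg) t).
pose E (z : 'I_N * 'I_N * 'I_T.+1 * bool) := [pred V : vecs | (z.1.1.2 <= z.1.1.1)%N &&
  (beta <= `|dotv (vec R (V z.1.1.1)) (X z.2 V z.1.1.2 z.1.2)|)].
apply: (le_trans (card_union_bound R (Q := E) _)).
  move=> V /=; rewrite negb_forall => /existsP[l].
  rewrite negb_forall => /existsP[i]; rewrite negb_imply => /andP[il].
  rewrite negb_forall => /existsP[t]; rewrite negb_and -!ltNge => /orP[h|h].
    by exists (l, i, t, true); rewrite /= il /X /= ltW.
  by exists (l, i, t, false); rewrite /= il /X /= ltW.
apply: (@le_trans _ _ (\sum_(z : 'I_N * 'I_N * 'I_T.+1 * bool)
    2 * expR (- (gam ^+ 2 * d%:R / 128)) * #|{: vecs}|%:R)); last first.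
  rewrite sumr_const !card_prod card_bool !card_ord -[leLHS]mulr_natl !natrM.
  by rewrite le_eqVlt; apply/orP; left; apply/eqP; ring.
apply: ler_sum => -[[[l i] t] k] _; rewrite /E /=.
have [il|il] := leqP i l; last first.
  by rewrite (_ : #|_| = 0%N) ?mulr_ge0 ?expR_ge0 //; apply: eq_card0.
apply: (card_mix_le (L := [set l]%SET)) => V.
have XV W : X k (mix [set l]%SET V W) i t = X k V i t.
  rewrite /X (@eq_prun_early _ _ V) // => l' l'i.
  by rewrite mixE inE; case: eqP => // l'l; move: l'i; rewrite l'l ltnNge il.
pose Q r := beta <= `|dotv (vec R r) (X k V i t)|.
rewrite (eq_card (B := [pred W : vecs | Q (W l)])); last first.
  by move=> W; rewrite !inE /= XV mixE inE eqxx.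
apply: card_marginal.
have Xn : dotv (X k V i t) (X k V i t) <= 1.
  have : normv (X k V i t) <= 1.
    by rewrite /X; case: k {XV Q}; [exact: query_in_ball|exact: output_in_ball].
  by rewrite normv_le ?ler01 // expr1n.
apply: le_trans (sign_tail_norm ltr01 Xn (ltW beta_gt0)) _.
rewrite card_signs natrX mulrA [leRHS]mulrAC ler_wpM2l ?mulr_ge0 ?exprn_ge0 //.
rewrite ler_expR lerN2 le_eqVlt; apply/orP; left; apply/eqP.
by rewrite /beta !exprMn sqr_sqrtr //; field.
Qed.

(** * Successful runs reveal all hidden vectors through correlated queries *)

Variable eps : R.
Hypothesis eps_small : eps < s * (3 / 4 * gam).

Definition objF A V := pwlF i0 s (slope Lam A V) (offset gam) xpredT.
Definition objG A V := pwlG i0 s (slope Lam A V) (offset gam) xpredT.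
Definition solves A V := eps_optimal (objF A V) eps (alg_out T alg (objF A V) (objG A V)).

Let ex_full : exists z : piece, xpredT z. Proof. by exists i0. Qed.

(** Otherwise the output is nearly orthogonal to the last hidden vector, whose piece has value at
    least [- N * gam + 3 / 4 * gam] there, while a solution has value at most [- N * gam]. After
    scaling by [s] this gap exceeds [eps]. *)
Lemma all_revealed A V : quiet A V -> solvable R A V -> solves A V ->
  (hit A V N.-1 < T.-1)%N.
Proof.
move=> q [y yb [yA yV]] [_ opt]; rewrite ltnNge; apply/negP => hT.
have lN : (N.-1 < N)%N by rewrite prednK.
pose l : 'I_N := Ordinal lN.
have [_ hx] := quietP (l := l) q (leqnn _) hT.
set x := output alg _ in hx.
have xE : alg_out T alg (objF A V) (objG A V) = x by [].
have := opt y yb; rewrite xE.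
have [_ hbx] := bestP i0 (slope Lam A V) (offset gam) x ex_full.
have hxl := hbx (inr l) isT; rewrite {1}/lin /= dotvZl in hxl.
have hx1 : - (gam / 4) <= sd^-1 * dotv (vec R (V l)) x.
  move: hx; rewrite ler_norml => /andP[hx _].
  rewrite -(ler_pM2l sd_gt0) mulVKf ?gt_eqF //; apply: le_trans hx.
  by rewrite /beta le_eqVlt; apply/orP; left; apply/eqP; field.
have gN : N%:R * gam = (4 * Num.sqrt N%:R)^-1.
  by rewrite gamE; field; rewrite !gt_eqF.
have sN1 : 1 <= Num.sqrt (N%:R : R).
  have : Num.sqrt 1 <= Num.sqrt (N%:R : R) by rewrite ler_wsqrtr // ler1n.
  by rewrite sqrtr1.
have gN1 : N%:R * gam <= 1.
  rewrite gN invf_le1 ?mulr_gt0 //; lra.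
have hy : lin (slope Lam A V) (offset gam) (best i0 (slope Lam A V) (offset gam) xpredT y) y
    <= - (N%:R * gam).
  case: (best _ _ _ _ y) => [[j e]|i]; rewrite /lin /= dotvZl.
    by rewrite yA mulr0 add0r lerN2.
  have : sd^-1 * dotv (vec R (V i)) y <= - (N%:R * gam).
    rewrite -(ler_pM2l sd_gt0) mulVKf ?gt_eqF //; apply: le_trans (yV i) _.
    rewrite gN le_eqVlt; apply/orP; left; apply/eqP.
    by rewrite -/sd; field; rewrite gt_eqF.
  have : 0 <= (i : nat)%:R * gam by rewrite mulr_ge0 // ltW.
  lra.
have eN : (N.-1)%:R = N%:R - 1 :> R by rewrite -subn1 natrB.
rewrite eN in hxl.
rewrite /objF /pwlF -mulrBr => h.
have : s * (3 / 4 * gam) <= eps.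
  by apply: le_trans h; rewrite ler_pM2l //; lra.
by rewrite leNgt eps_small.
Qed.

(** The oracle answers with some [l' > l], whose vector is still nearly orthogonal to the query, so
    the maximum is at most [gam / 4 - l' * gam]. Comparing it with the walls bounds the rows;
    comparing it with piece [l] forces correlation with the [l]-th vector. *)
Lemma hit_correlated A V (l : 'I_N) : quiet A V -> (hit A V l.+1 < T.-1)%N ->
  let x := qry A V (hit A V l.+1) in
  (forall j, `|dotv (vec R (A j)) x| <= 2 / Lam) /\
  dotv (vec R (V l)) x <= - (2 * beta).
Proof.
move=> q hT x.
have := reveals_hit hT; rewrite /reveals -/x.
have [_ hb] := bestP i0 (slope Lam A V) (offset gam) x ex_full.
rewrite -/(bst A V x) in hb; case: (bst A V x) hb => // l' hb ll'.
have [hx _] := quietP q ll' (leqnn _); rewrite -/x in hx.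
have top : lin (slope Lam A V) (offset gam) (inr l') x <= gam / 4 - (l'%:R) * gam.
  rewrite /lin /= dotvZl lerD2r -(ler_pM2l sd_gt0) mulVKf ?gt_eqF //.
  move: hx; rewrite ler_norml => /andP[_]; move=> /le_trans; apply.
  by rewrite /beta le_eqVlt; apply/orP; left; apply/eqP; field.
have ll'R : (l%:R : R) + 1 <= l'%:R by rewrite natr1 ler_nat.
have l0 : 0 <= (l%:R : R) by [].
have g0 := gam_gt0.
split=> [j|].
  have top1 : lin (slope Lam A V) (offset gam) (inr l') x <= 1.
    apply: le_trans top _; nra.
  have h e := le_trans (hb (inl (j, e)) isT) top1.
  have := h true; have := h false; rewrite /lin /= !dotvZl expr0 expr1.
  move=> h1 h2; rewrite ler_pdivlMr // mulrC -[Lam]gtr0_norm // -normrM ler_norml.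
  by apply/andP; split; lra.
have := le_trans (hb (inr l) isT) top; rewrite /lin /= dotvZl => h.
have {h} : sd^-1 * dotv (vec R (V l)) x <= - (3 / 4 * gam) by nra.
rewrite -(ler_pM2l sd_gt0) mulVKf ?gt_eqF // => /le_trans; apply.
rewrite /beta; have := mulr_gt0 g0 sd_gt0; lra.
Qed.

(** * Reduction of a short phase to the memory game *)

Variable m : nat.

(** If all [N.-1] phases took more than [m] steps, they would exceed the number of queries. *)
Lemma ex_short_phase A V : (T <= N.-1 * m.+1)%N -> (hit A V N.-1 < T.-1)%N ->
  exists2 l, (l < N.-1)%N & (hit A V l.+1 - hit A V l <= m)%N.
Proof.
move=> Tm hN; apply: contrapT => hn.
have {}hn l : (l < N.-1)%N -> (m < hit A V l.+1 - hit A V l)%N.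
  by move=> lN; rewrite ltnNge; apply/negP => le; apply: hn; exists l.
have : forall l, (l <= N.-1)%N -> (l * m.+1 <= hit A V l)%N.
  elim=> // l IH lN; have := hn _ lN; have := IH (ltnW lN); lia.
move=> /(_ _ (leqnn _)); lia.
Qed.

(** On this event with [t0] fixed, the memory at the start of the phase is a function of [A] and the
    hidden vectors of index below [l]. *)
Definition short (l : 'I_N) (t0 : 'I_T) : pred (mats * vecs) := fun x =>
  [&& (l.+1 < N)%N, quiet x.1 x.2, hit x.1 x.2 l == t0 :> nat,
      (hit x.1 x.2 l.+1 < T.-1)%N & (hit x.1 x.2 l.+1 - hit x.1 x.2 l <= m)%N].

Lemma ex_popular_phase (p : R) : (T <= N.-1 * m.+1)%N -> 0 < p ->
  p * (#|{: mats}|%:R * #|{: vecs}|%:R) <=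
    #|[pred x : mats * vecs | quiet x.1 x.2 && (hit x.1 x.2 N.-1 < T.-1)%N]|%:R ->
  exists l t0, p / (N%:R * T%:R) * (#|{: mats}|%:R * #|{: vecs}|%:R) <= #|short l t0|%:R.
Proof.
move=> Tm p0 hp; apply: contrapT => hn.
have {}hn z : #|short z.1 z.2|%:R < p / (N%:R * T%:R) * (#|{: mats}|%:R * #|{: vecs}|%:R).
  rewrite ltNge; apply/negP => le; apply: hn; exists z.1, z.2; exact: le.
set X : R := #|{: mats}|%:R * #|{: vecs}|%:R in hp hn.
have X0 : 0 < X by rewrite mulr_gt0 // ltr0n card_ffun card_signs !expn_gt0.
have hU := card_union_bound R (P := [pred x : mats * vecs | quiet x.1 x.2 && (hit x.1 x.2 N.-1 < T.-1)%N])
  (Q := fun z : 'I_N * 'I_T => short z.1 z.2).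
have {hU} : p * X <= \sum_(z : 'I_N * 'I_T) #|short z.1 z.2|%:R.
  apply: le_trans hp (hU _) => -[A V] /= /andP[q hN].
  have [l lN sh] := ex_short_phase Tm hN.
  have lN' : (l < N)%N by exact: leq_trans lN (leq_pred N).
  have hl : (hit A V l.+1 < T.-1)%N by apply: leq_ltn_trans hN; exact: hit_mono.
  have tT : (hit A V l < T)%N.
    by apply: leq_ltn_trans (hit_mono A V (leqnSn l)) (leq_trans hl (leq_pred T)).
  exists (Ordinal lN', Ordinal tT); rewrite /short /= q hl sh eqxx !andbT /=.
  by rewrite -ltn_predRL.
have T0 : (0 < T)%N.
  case: (posnP T) => // T0; move: hp; rewrite (_ : #|_| = 0%N) => [|{hn}].
    by rewrite leNgt mulr_gt0.
  by apply: eq_card0 => x; rewrite !inE T0 andbF.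
apply/negP; rewrite -ltNge.
apply: (@lt_le_trans _ _ (\sum_(z : 'I_N * 'I_T) p / (N%:R * T%:R) * X)).
  apply: ltr_sum => [|z _]; last exact: hn.
  by apply/hasP; exists (Ordinal N_gt0, Ordinal T0); rewrite ?mem_index_enum.
rewrite sumr_const card_prod !card_ord -[leLHS]mulr_natl natrM.
have T0R : 0 < (T%:R : R) by rewrite ltr0n.
rewrite le_eqVlt; apply/orP; left; apply/eqP; field.
by rewrite !gt_eqF.
Qed.

Variables (K h u : nat).
Hypotheses (K_even : K = (2 * h)%N) (h_gt0 : (0 < h)%N).
Hypothesis n_large : (8 * m + 8 * u <= n)%N.
Hypothesis Lam_large : d%:R * K%:R ^+ 2 * (2 / Lam) < (gam / 4) ^+ 2.

Let qc : R := (4 * K + 2)%:R ^+ K * expR (- (gam ^+ 2 * d%:R / 2048)).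

Lemma hidden_spread (l : 'I_N) r q : (r <= K)%N -> orthosys r q ->
  #|[pred W : vecs | (beta / 2) ^+ 2 <= \sum_(k < r) dotv (vec R (W l)) (q k) ^+ 2]|%:R
    <= qc * #|{: vecs}|%:R.
Proof.
move=> rK oq.
apply: (card_marginal l (Q := fun a => (beta / 2) ^+ 2 <= \sum_(k < r) dotv (vec R a) (q k) ^+ 2)).
have b2 : 0 < beta / 2 by rewrite divr_gt0.
apply: le_trans (span_tail oq b2) _.
rewrite card_signs natrX -[leRHS]mulrA (mulrC _ (2 ^+ d)).
have -> : (beta / 2) ^+ 2 / 32 = gam ^+ 2 * d%:R / 2048.
  by rewrite /beta !exprMn sqr_sqrtr //; field.
rewrite ler_wpM2r ?mulr_ge0 ?exprn_ge0 ?expR_ge0 //.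
have k1 : 1 <= (4 * K + 2)%:R :> R by rewrite ler1n addn2.
apply: (@le_trans _ _ ((4 * K + 2)%:R ^+ r)); last exact: ler_weXn2l.
case: r {rK oq q} (rK) => [|r] rK; first by rewrite !expr0.
by rewrite ler_pXn2r ?nnegrE // ler_nat leq_add2r leq_mul2l rK orbT.
Qed.

(** Averaging fixes all hidden vectors except the [l]-th, which remains fresh. *)
Lemma ex_typical_rest (l : 'I_N) (E : pred (mats * vecs)) (c : R) :
  c * (#|{: mats}|%:R * #|{: vecs}|%:R) <= #|E|%:R ->
  exists V, c * (#|{: mats}|%:R * #|{: vecs}|%:R) <=
    #|[pred x : mats * vecs | E (x.1, mix [set l]%SET V x.2)]|%:R.
Proof.
move=> hE; apply: contrapT => hn.
set X := c * _ in hE hn.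
have {}hn V : #|[pred x : mats * vecs | E (x.1, mix [set l]%SET V x.2)]|%:R < X.
  by rewrite ltNge; apply/negP => le; apply: hn; exists V.
have e : (\sum_V #|[pred x : mats * vecs | E (x.1, mix [set l]%SET V x.2)]| =
    #|{: vecs}| * #|E|)%N.
  under eq_bigr do rewrite card_pred_pair.
  rewrite exchange_big /= card_pred_pair big_distrr /=; apply: eq_bigr => A _.
  exact: (sum_card_mix [set l]%SET (fun V => E (A, V))).
have : \sum_V #|[pred x : mats * vecs | E (x.1, mix [set l]%SET V x.2)]|%:R <
    \sum_(V : vecs) X.
  apply: ltr_sum => [|V _]; last exact: hn.
  by apply/hasP; exists [ffun=> [ffun=> true]]; rewrite ?mem_index_enum.
rewrite -natr_sum e natrM sumr_const -[ltRHS]mulr_natl ltNge => /negP; apply.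
by rewrite ler_wpM2l.
Qed.

Lemma phase_bound (l : 'I_N) (t0 : 'I_T) (p : R) : 0 < p ->
  p * (#|{: mats}|%:R * #|{: vecs}|%:R) <= #|short l t0|%:R ->
  4 * qc <= p * (7 / 8) ^+ u ->
  p * (7 / 8) ^+ u / 2 * (p * (7 / 8) ^+ u / 4) ^+ K * 2 ^+ (h * u) <=
    2 ^+ S * m.+1%:R ^+ K.
Proof.
move=> p0 hshort hq; have [V hV] := ex_typical_rest l hshort.
have -> : 2 ^+ S = #|{ffun 'I_S -> bool}|%:R :> R.
  by rewrite card_ffun card_bool card_ord natrX.
pose V' W := mix [set l]%SET V W.
have vecs0 : (0 < #|{: vecs}|)%N by rewrite card_ffun card_signs !expn_gt0.
have gam4 : gam / 4 <= 1.
  by rewrite ler_pdivrMr // mul1r (le_trans gam_le1) // ler1n.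
have rho_beta : Num.sqrt d%:R * (gam / 4) <= beta.
  by rewrite /beta le_eqVlt; apply/orP; left; apply/eqP; rewrite /sd mulrCA mulrA.
(* The replay sees the [l]-th vector, hence the bound [l.+1], but no later one and no row of [U]. *)
pose Y U (M : {ffun 'I_S -> bool}) A W t := query alg (prun A (V' W) (outside U l.+1) M t).
apply: (@game_bound R d n K h m u {ffun 'I_S -> bool} vecs (fun W => W l)
  (fun A => prun A V (early l) (mem0 alg) t0) Y beta (gam / 4) (2 / Lam) qc
  _ _ _ _ _ _ _ _ _ _ p [pred x : mats * vecs | short l t0 (x.1, V' x.2)]) => //.
- by rewrite divr_gt0.
- move=> U M A A' W t AA'; rewrite /Y; congr query; apply: eq_run.
    by exists (inr l) => /=.
  by move=> [[j e]|l'] //= jU; rewrite AA'.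
- by move=> r q; exact: hidden_spread.
- move=> A W; rewrite /= /short /= => /and5P[lN q /eqP ht0 hT hm].
  set t1 := hit A (V' W) l.+1 in hT hm.
  have t01 : (t0 <= t1)%N by rewrite -ht0 /t1; exact: hit_mono.
  (* [Q] collects the rows whose walls are answers during the phase: at most one per query. *)
  pose f k : option 'I_n := if bst A (V' W) (qry A (V' W) k) is inl (j, _) then Some j else None.
  pose Q := [set j in pmap f (iota t0 (t1 - t0))]%SET.
  exists (t1 - t0)%N; first by rewrite -ht0.
  exists Q => [|U UQ].
    rewrite /Q cardsE; apply: leq_trans (card_size _) _.
    rewrite size_pmap; apply: leq_trans (count_size _ _) _.
    by rewrite size_iota -ht0.
  have M0E : prun A V (early l) (mem0 alg) t0 = traj A (V' W) t0.
    rewrite -(@traj_early A (V' W) l) ?ht0 //; apply: eq_prun_early => l' l'l.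
    by rewrite /V' mixE inE; case: eqP => // e; move: l'l; rewrite e ltnn.
  (* Before time [t1] every answer is a wall of a row in [Q] or a vector of index at most [l], so
     withholding [U] changes nothing. *)
  have YE : Y U (prun A V (early l) (mem0 alg) t0) A W (t1 - t0)%N = qry A (V' W) t1.
    rewrite /Y M0E /qry; congr query.
    rewrite -{2}(subnKC t01) /traj /prun runD -/(prun _ _ _ _ t0).
    apply: run_sub => // k kt; rewrite -runD -/(prun _ _ _ _ _) -/(traj _ _ _) -/(qry _ _ _) -/(bst _ _ _).
    have kt1 : (t0 + k < t1)%N by rewrite -ltn_subRL.
    have := reveals_early (before_hit kt1).
    case E : (bst A (V' W) (qry A (V' W) (t0 + k))) => [[j e]|l'] //= _.
    apply/negP => jU; have := fintype.subsetP UQ j jU.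
    rewrite !inE mem_pmap => /mapP; apply; exists (t0 + k)%N; last by rewrite /f E.
    by rewrite mem_iota leq_addr /= ltn_add2l.
  have [hrow hv] := hit_correlated (l := l) q hT.
  apply/asboolP; rewrite YE; split; first exact: query_in_ball.
  split=> [j _|]; first exact: hrow.
  have -> : W l = V' W l by rewrite /V' mixE inE eqxx.
  exact: hv.
Qed.

(** Noise and unsolvability cost 1/100 each, so success on 3/5 of the instances leaves at least half
    for [ex_popular_phase]; division by the [N * T] pairs of phase and start time gives [p]. *)
Lemma success_bound : (T <= N.-1 * m.+1)%N ->
  4 * N%:R ^+ 2 * T.+1%:R * expR (- (gam ^+ 2 * d%:R / 128)) <= 1 / 100 ->
  N%:R * ((4 * n + 2)%:R ^+ n * expR (- (d%:R / 128))) +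
    N%:R ^+ 2 * (2 * expR (- (d%:R / (128 * N%:R ^+ 2)))) <= 1 / 100 :> R ->
  3 / 5 * (#|{: mats}|%:R * #|{: vecs}|%:R) <=
    #|[pred x : mats * vecs | `[< solves x.1 x.2 >] ]|%:R :> R ->
  let p : R := 1 / (2 * N%:R * T%:R) in
  4 * qc <= p * (7 / 8) ^+ u ->
  p * (7 / 8) ^+ u / 2 * (p * (7 / 8) ^+ u / 4) ^+ K * 2 ^+ (h * u) <=
    2 ^+ S * m.+1%:R ^+ K.
Proof.
move=> Tm noisy unsolv succ p hq.
set X : R := #|{: mats}|%:R * #|{: vecs}|%:R in succ.
have X0 : 0 < X by rewrite mulr_gt0 // ltr0n card_ffun card_signs !expn_gt0.
set E := [pred x : mats * vecs | quiet x.1 x.2 && (hit x.1 x.2 N.-1 < T.-1)%N].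
have E2 : 1 / 2 * X <= #|E|%:R.
  have h1 := card_noisy; rewrite -/X in h1.
  have h2 : #|[pred x : mats * vecs | ~~ `[< solvable R x.1 x.2 >] ]|%:R <= 1 / 100 * X.
    apply: card_pair_le => A; apply: le_trans (card_unsolvable R d_gt0 N_gt0 A) _.
    by rewrite ler_wpM2r.
  have h1' := ler_wpM2r (ltW X0) noisy.
  have h3 : #|[pred x : mats * vecs | `[< solves x.1 x.2 >] ]|%:R <=
      #|[pred x : mats * vecs | ~~ quiet x.1 x.2]|%:R +
      #|[pred x : mats * vecs | ~~ `[< solvable R x.1 x.2 >] ]|%:R + #|E|%:R :> R.
    pose F (k : 'I_3) : pred (mats * vecs) := match val k with
      | 0 => [pred x | ~~ quiet x.1 x.2]
      | 1 => [pred x | ~~ `[< solvable R x.1 x.2 >] ]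
      | _ => E end.
    have := card_union_bound R (P := [pred x : mats * vecs | `[< solves x.1 x.2 >] ]) (Q := F).
    rewrite !big_ord_recl big_ord0 addr0 /= addrA; apply => -[A V] /= /asboolP sol.
    have [q|nq] := boolP (quiet A V); last by exists ord0.
    have [sv|nsv] := pselect (solvable R A V); last first.
      by exists (lift ord0 ord0) => /=; apply/asboolPn.
    by exists ord_max; rewrite /F /E /= q /=; exact: all_revealed.
  lra.
have T0 : (0 < T)%N.
  case: (posnP T) => // T0; move: E2; rewrite (_ : #|E| = 0%N) => [|{hq}].
    by rewrite leNgt mulr_gt0.
  by apply: eq_card0 => x; rewrite !inE T0 andbF.
have half0 : 0 < 1 / 2 :> R by [].
have [l [t0]] := ex_popular_phase Tm half0 E2.
have -> : 1 / 2 / (N%:R * T%:R) = p.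
  have T0R : 0 < (T%:R : R) by rewrite ltr0n.
  by rewrite /p; field; rewrite !gt_eqF.
move=> hs; apply: (phase_bound _ hs hq).
by rewrite /p divr_gt0 // !mulr_gt0 // ltr0n.
Qed.

End Phases.

(** * Derandomization and choice of parameters *)

(** The averaging half of Yao's principle: the expected number of solved instances is at least
    [q * #|Z|]. The measurable inner sets carry the integral, since [G z] itself may fail to be
    measurable. *)
Lemma ex_frequent_outcome (R : realType) (dO : measure_display)
    (Omega : measurableType dO) (P : probability Omega R) (Z : finType)
    (G : Z -> set Omega) (q q' : R) : q' < q -> (0 < #|Z|)%N ->
  (forall z, exists B : set Omega, measurable B /\ B `<=` G z /\ (q%:E <= P B)%E) ->
  exists w, q' * #|Z|%:R <= #|[pred z | `[< G z w >] ]|%:R.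
Proof.
move=> qq' Z0 hG; have [B hB] := choice hG.
apply: contrapT => /forallNP hn.
have mB z : measurable (B z) by have [] := hB z.
have cnt w : \sum_z \1_(B z) w <= q' * #|Z|%:R.
  apply/ltW/(@le_lt_trans _ _ #|[pred z | `[< G z w >] ]|%:R); last first.
    by rewrite ltNge; apply/negP.
  rewrite -sum1_card natr_sum [leRHS]big_mkcond /=; apply: ler_sum => z _.
  rewrite indicE unfold_in /=; case: asboolP => Gz.
    by case: (_ \in _).
  by rewrite memNset // => Bz; apply: Gz; have [_ [+ _]] := hB z; apply.
have sumP : (\sum_z P (B z) <= (q' * #|Z|%:R)%:E)%E.
  have -> : (\sum_z P (B z) = \int[P]_w (\sum_z (\1_(B z) w)%:E))%E.
    rewrite ge0_integral_sum //.
    - by apply: eq_bigr => z _; rewrite integral_indic // setIT.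
    - move=> z; apply/measurable_EFinP; exact: measurable_indic.
  apply: (@le_trans _ _ (\int[P]_w (q' * #|Z|%:R)%:E)%E).
    apply: ge0_le_integral => //.
    - by move=> w _; apply: sume_ge0.
    - apply: emeasurable_sum.
      by move=> z; exact/measurable_EFinP/measurable_indic.
    - by move=> w _; rewrite sumEFin lee_fin cnt.
  rewrite integral_cst //.
  rewrite [X in (_ * X)%E](probability_setT P) mule1.
  by [].
have : ((q * #|Z|%:R)%:E <= \sum_z P (B z))%E.
  have -> : (q * #|Z|%:R)%:E = (\sum_(z : Z) q%:E)%E.
    by rewrite sumEFin sumr_const mulr_natr.
  by apply: lee_sum => z _; have [_ []] := hB z.
move=> /le_trans /(_ sumP); rewrite lee_fin ler_pM2r ?ltr0n //.
by rewrite leNgt qq'.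
Qed.

(** * Numerical verification of the parameter choice *)

Section ParameterChoice.
Variables (R : realType) (dl r : R) (d : nat).
Let L : R := ln d%:R.
Let D : R := d%:R.
Hypotheses (d_gt0 : (0 < d)%N) (dl_gt0 : 0 < dl) (dl_lt1 : dl < 1).
Hypotheses (r_dl : 12 / dl <= r) (r_large : (27 * 1024 * 1024) <= r) (r2 : r ^+ 2 = L).
Let E : R := expR r.

Let DE : D = expR L. Proof. by rewrite lnK // posrE ltr0n. Qed.
Let D_gt0 : 0 < D. Proof. by rewrite ltr0n. Qed.
Let r_gt0 : 0 < r. Proof. by have := r_large; lra. Qed.
Let rL : (27 * 1024 * 1024) * r <= L.
Proof. by have h := r_large; have h0 := r_gt0; rewrite -r2 expr2 ler_pM2r. Qed.
Let L_large : (27 * 1024 * 1024) <= L.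
Proof. by have h := r_large; have := rL; lra. Qed.
Let L_gt0 : 0 < L. Proof. by have := L_large; lra. Qed.

(** From expR r >= (r / 3)^3 = (r / 27) r^2; this fixes the constant in [r_large]. *)
Let E_large : (1024 * 1024) * L <= E.
Proof.
have e : E = expR (r / 3) ^+ 3 by rewrite /E -expRM_natr; congr expR; field.
have h1 : r / 3 <= expR (r / 3) by have := expR_ge1Dx (r / 3); lra.
have h2 : (r / 3) ^+ 3 <= E.
  by rewrite e lerXn2r // nnegrE ?expR_ge0 // divr_ge0 // ltW.
apply: le_trans h2; rewrite -r2.
have -> : (r / 3) ^+ 3 = r / 27 * r ^+ 2 by field.
by rewrite ler_wpM2r ?sqr_ge0 //; have := r_large; lra.
Qed.

Let E_ge : (1024 * 1024) <= E.
Proof. by apply: le_trans E_large; have := L_large; lra. Qed.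

(* With [r = sqrt (ln d)], the factor [E = expR r] is d^(o(1)) but beats every
   power of [ln d] and every constant. [par_g] is [par_gam ^+ 2 * d], of order
   d^(1 - delta/2) * E^3, and the final bound on [S] is of order
   [par_g ^+ 2 / ln d]. *)
Definition par_x : R := expR (dl / 6 * L - r).
Definition par_N := Num.truncn par_x.
Definition par_g : R := D / (16 * par_N%:R ^+ 3).
(** The constants keep the losses below the concentration gains: (7/8)^u and d^(O(h)) against expR
    (- par_g / 2048), and the net of size (4n + 2)^n against expR (- d / 128). *)
Definition par_u := Num.truncn (par_g / 2048).
Definition par_h := Num.truncn (par_g / ((32 * 1024) * L)).
Definition par_n := Num.truncn (D / (1024 * L)).
Definition par_m := (par_n %/ 16)%N.

(** Requires [dl / 6 * L >= 2 * r], which is where the bound [12 / dl] on [r] comes from. *)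
Let x_ge : E <= par_x.
Proof.
rewrite ler_expR -r2.
have h : 12 <= r * dl by rewrite -ler_pdivrMr.
have h0 := r_gt0; nra.
Qed.

Lemma truncn_bounds (y : R) : 0 <= y -> (Num.truncn y)%:R <= y /\ y < (Num.truncn y)%:R + 1.
Proof. by move=> /truncn_itv/andP[h1 h2]; rewrite -natr1 in h2. Qed.

Let N_le : par_N%:R <= par_x. Proof. by have [] := truncn_bounds (expR_ge0 (dl / 6 * L - r)). Qed.
Let N_ge : par_x / 2 + 1 <= par_N%:R.
Proof.
have [_ h] := truncn_bounds (expR_ge0 (dl / 6 * L - r)).
rewrite -/par_x -/par_N in h; have := le_trans E_ge x_ge; lra.
Qed.
Let N_large : L <= par_N%:R.
Proof. have := N_ge; have := x_ge; have := E_large; have := L_gt0; lra. Qed.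

Lemma par_N_gt1 : (1 < par_N)%N.
Proof. by rewrite -(@ltr_nat R); have := N_large; have := L_large; lra. Qed.

Let N_gt0 : 0 < par_N%:R :> R.
Proof. by have := N_large; have := L_gt0; lra. Qed.

Let N3_le : par_N%:R ^+ 3 <= expR (dl / 2 * L - 3 * r).
Proof.
have -> : expR (dl / 2 * L - 3 * r) = par_x ^+ 3.
  by rewrite -expRM_natr; congr expR; field.
by rewrite lerXn2r // nnegrE ?expR_ge0.
Qed.

Let N3_leh : par_N%:R ^+ 3 <= expR (L / 2).
Proof.
apply: le_trans N3_le _; rewrite ler_expR.
have := r_gt0; have := L_gt0; have := dl_lt1; nra.
Qed.

Let N_leh : par_N%:R <= expR (L / 2).
Proof.
apply: le_trans N3_leh; rewrite -[leLHS]expr1 ler_weXn2l //.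
by have := N_large; have := L_large; lra.
Qed.

Let gNE : par_g = D / par_N%:R ^+ 3 / 16.
Proof. by rewrite /par_g; field; rewrite gt_eqF. Qed.

Let g_gt0 : 0 < par_g.
Proof. by rewrite divr_gt0 // mulr_gt0 // exprn_gt0. Qed.

Let g_ge : expR ((1 - dl / 2) * L) * E ^+ 3 / 16 <= par_g.
Proof.
have N3 : 0 < par_N%:R ^+ 3 :> R by rewrite exprn_gt0.
rewrite gNE ler_wpM2r //.
rewrite ler_pdivlMr //.
have -> : D = expR ((1 - dl / 2) * L) * E ^+ 3 * expR (dl / 2 * L - 3 * r).
  by rewrite DE /E -expRM_natr -!expRD; congr expR; field.
by rewrite ler_wpM2l ?N3_le // mulr_ge0 ?exprn_ge0 ?expR_ge0.
Qed.

Let g_large : E ^+ 2 <= par_g.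
Proof.
apply: le_trans g_ge.
have h1 : 1 <= expR ((1 - dl / 2) * L).
  apply: (@le_trans _ _ (expR 0)); first by rewrite expR0.
  rewrite ler_expR mulr_ge0 ?(ltW L_gt0) //; have := dl_lt1; lra.
have h3 := E_ge.
have -> : expR ((1 - dl / 2) * L) * E ^+ 3 / 16 = E ^+ 2 * (expR ((1 - dl / 2) * L) * E / 16) by field.
rewrite ler_peMr //; nra.
Qed.

Let g_geL : (1024 * 1024) * L <= par_g.
Proof.
apply: le_trans g_large; rewrite expr2; have := E_large; have := E_ge; have := L_gt0; nra.
Qed.

Let u_le : par_u%:R <= par_g / 2048.
Proof. by rewrite truncn_le divr_ge0 ?ler0n ?(ltW g_gt0). Qed.
Let u_ge : par_g / (4 * 1024) <= par_u%:R.
Proof.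
have g0 : 0 <= par_g / 2048 by rewrite divr_ge0 ?ler0n ?(ltW g_gt0).
have [_] := truncn_bounds g0; rewrite -/par_u.
have := g_geL; have := L_large; lra.
Qed.
Let h_le : par_h%:R <= par_g / ((32 * 1024) * L).
Proof. by rewrite truncn_le divr_ge0 ?(ltW g_gt0) ?mulr_ge0 ?mulr_ge0 ?ler0n ?(ltW L_gt0). Qed.
Let gL_ge : (1024 * 1024) <= par_g / L.
Proof. by rewrite ler_pdivlMr ?L_gt0 // g_geL. Qed.
Let gLE : par_g / ((32 * 1024) * L) = par_g / L / (32 * 1024).
Proof. by field; rewrite gt_eqF ?L_gt0. Qed.
Let gLL : par_g = par_g / L * L. Proof. by rewrite divfK // gt_eqF // L_gt0. Qed.

Let gL_ge' : (1024 * 1024) * E <= par_g / L.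
Proof.
rewrite ler_pdivlMr ?L_gt0 //; apply: le_trans g_large.
rewrite expr2; have := E_large; have := E_ge; nra.
Qed.

Let h_ge : par_g / L / (64 * 1024) <= par_h%:R.
Proof.
have g0 : 0 <= par_g / ((32 * 1024) * L) by rewrite divr_ge0 ?(ltW g_gt0) ?mulr_ge0 ?mulr_ge0 ?ler0n ?(ltW L_gt0).
have [_] := truncn_bounds g0; rewrite -/par_h gLE.
have := gL_ge'; have := E_ge; lra.
Qed.

Lemma par_h_ge : (100 <= par_h)%N.
Proof. rewrite -(@ler_nat R); have := h_ge; have := gL_ge'; have := E_ge; lra. Qed.

Let D_geL : (1024 * 1024) * L <= D.
Proof.
have : E <= D by rewrite DE ler_expR; have := rL; have := r_gt0; lra.
have := E_large; lra.
Qed.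
Let DL_ge : (1024 * 1024) <= D / L.
Proof. by rewrite ler_pdivlMr ?L_gt0 // D_geL. Qed.
Let DLE : D / (1024 * L) = D / L / 1024.
Proof. by field; rewrite gt_eqF ?L_gt0. Qed.

Let n_le : par_n%:R <= D / L / 1024.
Proof. by rewrite -DLE truncn_le divr_ge0 ?(ltW D_gt0) ?mulr_ge0 ?mulr_ge0 ?ler0n ?(ltW L_gt0). Qed.
Let n_ge : D / L / 2048 <= par_n%:R.
Proof.
have g0 : 0 <= D / (1024 * L) by rewrite divr_ge0 ?(ltW D_gt0) ?mulr_ge0 ?mulr_ge0 ?ler0n ?(ltW L_gt0).
have [_] := truncn_bounds g0; rewrite -/par_n DLE.
have := DL_ge; lra.
Qed.

Lemma par_n_gt0 : (0 < par_n)%N.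
Proof. rewrite -(@ltr_nat R); have := n_ge; have := DL_ge; lra. Qed.

Let m_le : par_m%:R <= par_n%:R / 16 :> R.
Proof. by rewrite ler_pdivlMr // -natrM ler_nat leq_divM. Qed.
Let m_ge : par_n%:R / 16 <= par_m.+1%:R :> R.
Proof. by rewrite ler_pdivrMr // -natrM ler_nat ltnW // ltn_ceil. Qed.

Lemma par_n_large : (8 * par_m + 8 * par_u <= par_n)%N.
Proof.
rewrite -(@ler_nat R) natrD !natrM.
suff : par_u%:R <= par_n%:R / 16 :> R by have := m_le; lra.
apply: le_trans u_le _; apply: (@le_trans _ _ (D / L / (32 * 1024))); last by have := n_ge; lra.
suff : par_g <= D / L / 16 by lra.
rewrite gNE ler_wpM2r //.
rewrite ler_wpM2l ?(ltW D_gt0) // lef_pV2 ?posrE ?exprn_gt0 ?L_gt0 //.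
apply: le_trans N_large _; rewrite -{1}[par_N%:R]expr1 ler_weXn2l //.
by have := N_large; have := L_large; lra.
Qed.

Let D_ge : 1024 * 1024 <= D.
Proof. by have := D_geL; have := L_large; lra. Qed.

Let N_ge1 : 1 <= par_N%:R :> R.
Proof. by have := N_large; have := L_large; lra. Qed.

Let expNL_le : expR (- L) <= 1 / (1024 * 1024).
Proof.
have h : 0 < 1024 * 1024 :> R by rewrite mulr_gt0 ?ltr0n.
by rewrite expRN -DE mul1r lef_pV2 ?posrE ?h ?D_gt0 ?D_ge.
Qed.

Definition par_gam : R := (4 * (par_N%:R * Num.sqrt par_N%:R))^-1.

Lemma par_gam2 : par_gam ^+ 2 * D = par_g.
Proof.
have sN : Num.sqrt par_N%:R ^+ 2 = par_N%:R :> R by rewrite sqr_sqrtr ?ler0n.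
rewrite /par_gam /par_g exprVn.
have -> : (4 * (par_N%:R * Num.sqrt par_N%:R)) ^+ 2 = 16 * par_N%:R ^+ 3 :> R.
  by rewrite !exprMn sN; ring.
by rewrite mulrC.
Qed.

Variable T : nat.
Hypotheses (T_gt0 : (0 < T)%N) (T_le : T%:R <= expR ((1 + dl / 6) * L - 2 * r)).

Let T_le2 : T%:R <= expR (2 * L).
Proof.
apply: le_trans T_le _; rewrite ler_expR.
have := r_gt0; have := L_gt0; have := dl_lt1; nra.
Qed.

Let N2_le : par_N%:R ^+ 2 <= expR L.
Proof.
have -> : expR L = expR (L / 2) ^+ 2 by rewrite -expRM_natr; congr expR; field.
by rewrite lerXn2r // nnegrE ?expR_ge0.
Qed.

Let expR_gt1 (y : R) : 0 <= y -> 1 <= expR y.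
Proof. by move=> y0; have := expR_ge1Dx y; lra. Qed.

Lemma par_noisy :
  4 * par_N%:R ^+ 2 * T.+1%:R * expR (- (par_gam ^+ 2 * D / 128)) <= 1 / 100.
Proof.
rewrite par_gam2.
have h1 : expR (- (par_g / 128)) <= expR (- (4 * L)).
  by rewrite ler_expR; have := g_geL; have := L_gt0; lra.
have h2 : T.+1%:R <= 2 * expR (2 * L).
  have LL : 0 <= 2 * L by rewrite mulr_ge0 // ltW // L_gt0.
  by have := expR_gt1 LL; have := T_le2; rewrite -natr1; lra.
have h3 : par_N%:R ^+ 2 * T.+1%:R <= expR L * (2 * expR (2 * L)).
  by apply: ler_pM => //; rewrite sqr_ge0.
have h4 : par_N%:R ^+ 2 * T.+1%:R * expR (- (par_g / 128)) <=
    expR L * (2 * expR (2 * L)) * expR (- (4 * L)).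
  by apply: ler_pM => //; rewrite ?mulr_ge0 ?sqr_ge0 ?expR_ge0.
have e : expR L * (2 * expR (2 * L)) * expR (- (4 * L)) = 2 * expR (- L).
  rewrite mulrCA -mulrA -!expRD; congr (_ * expR _); ring.
rewrite e in h4; have := expNL_le.
set X := expR (- (par_g / 128)) in h4 *; set a := par_N%:R ^+ 2 in h4 *.
have -> : 4 * a * T.+1%:R * X = 4 * (a * T.+1%:R * X) by ring.
lra.
Qed.

Let D2_le (k : nat) : k%:R <= D -> (4 * k + 2)%:R <= expR (2 * L).
Proof.
move=> kD; have -> : expR (2 * L) = D * D by rewrite DE -expRD; congr expR; ring.
rewrite natrD natrM; have := D_ge; nra.
Qed.

Let n_leD : par_n%:R <= D.
Proof.
apply: le_trans n_le _.
have : D / L <= D by rewrite ler_pdivrMr ?L_gt0 // ler_peMr ?(ltW D_gt0) //; have := L_large; lra.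
by have := D_gt0; lra.
Qed.

Lemma par_unsolvable : par_N%:R * ((4 * par_n + 2)%:R ^+ par_n * expR (- (D / 128))) +
  par_N%:R ^+ 2 * (2 * expR (- (D / (128 * par_N%:R ^+ 2)))) <= 1 / 100.
Proof.
have h1 : (4 * par_n + 2)%:R ^+ par_n <= expR (D / 512).
  apply: (@le_trans _ _ (expR (2 * L) ^+ par_n)).
    by rewrite lerXn2r ?nnegrE ?expR_ge0 // D2_le.
  rewrite -expRM_natr ler_expR.
  have h := ler_wpM2l (ltW L_gt0) n_le.
  have e : L * (D / L / 1024) = D / 1024 by field; rewrite gt_eqF // L_gt0.
  by rewrite e in h; lra.
have h2 : par_N%:R * ((4 * par_n + 2)%:R ^+ par_n * expR (- (D / 128))) <= expR (- L).
  apply: (@le_trans _ _ (expR (L / 2) * (expR (D / 512) * expR (- (D / 128))))).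
    apply: ler_pM => //; rewrite ?mulr_ge0 ?exprn_ge0 ?expR_ge0 //.
    by rewrite ler_wpM2r ?expR_ge0.
  by clear h1; rewrite -!expRD ler_expR; have := D_geL; have := L_gt0; lra.
have h3 : expR (- (D / (128 * par_N%:R ^+ 2))) <= expR (- (2 * L)).
  rewrite ler_expR lerN2.
  have e : D / (128 * par_N%:R ^+ 2) = par_g * par_N%:R / 8.
    by rewrite /par_g; field; rewrite gt_eqF.
  rewrite e; clear h1 h2 e.
  by have := ler_wpM2l (ltW g_gt0) N_ge1; have := g_geL; have := L_gt0; lra.
have h4 : par_N%:R ^+ 2 * (2 * expR (- (D / (128 * par_N%:R ^+ 2)))) <= 2 * expR (- L).
  apply: (@le_trans _ _ (expR L * (2 * expR (- (2 * L))))).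
    by apply: ler_pM; rewrite ?sqr_ge0 ?mulr_ge0 ?expR_ge0 // ler_wpM2l.
  by rewrite mulrCA -expRD le_eqVlt; apply/orP; left; apply/eqP; congr (_ * expR _); ring.
apply: le_trans (lerD h2 h4) _; clear h1 h2 h3 h4.
have := expNL_le; set y := expR _; lra.
Qed.

(** Steep enough that [2 / par_Lam] meets the threshold of Cramer's rule, yet polynomial in [d], so
    that the optimality gap stays far above the target accuracy. *)
Definition par_Lam : R := D ^+ 8.

Lemma par_Lam_gt0 : 0 < par_Lam. Proof. exact: exprn_gt0. Qed.

Let sN_le : Num.sqrt par_N%:R <= par_N%:R :> R.
Proof.
have h : Num.sqrt (par_N%:R : R) ^+ 2 = par_N%:R by rewrite sqr_sqrtr ?ler0n.
have h0 := sqrtr_ge0 (par_N%:R : R); have h1 := N_ge1; nra.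
Qed.

Let NsN_le : par_N%:R * Num.sqrt par_N%:R <= D.
Proof.
rewrite DE; apply: le_trans N2_le; rewrite expr2 ler_wpM2l //.
Qed.

Let sN_gt0 : 0 < Num.sqrt (par_N%:R : R). Proof. by rewrite sqrtr_gt0. Qed.

(** The gap is at least [D ^- 11], and [L ^+ 5 > 11 * L]. *)
Lemma par_eps : expR (- L ^+ 5) < 1 / (par_Lam * D) * (3 / 4 * par_gam).
Proof.
have -> : 1 / (par_Lam * D) * (3 / 4 * par_gam) =
    3 / (16 * (D ^+ 9 * (par_N%:R * Num.sqrt par_N%:R))).
  by rewrite /par_Lam /par_gam; field; rewrite !gt_eqF.
apply: (@lt_le_trans _ _ (expR (- (11 * L)))).
  rewrite ltr_expR ltrN2 exprSr ltr_pM2r ?L_gt0 //.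
  have h : 11 <= L by have := L_large; lra.
  have h2 : 11 < L ^+ 2 by rewrite expr2; nra.
  have -> : L ^+ 4 = L ^+ 2 * L ^+ 2 by ring.
  nra.
have -> : expR (- (11 * L)) = (D ^+ 11)^-1.
  by rewrite expRN DE -expRM_natr; congr (expR _)^-1; ring.
have D9 : 0 < D ^+ 9 by rewrite exprn_gt0.
rewrite ler_pdivlMr ?mulr_gt0 // mulrC ler_pdivrMr ?exprn_gt0 //.
have -> : D ^+ 11 = D ^+ 9 * (D * D) by ring.
rewrite mulrCA [leRHS]mulrCA ler_wpM2l ?(ltW D9) //.
have := NsN_le; have := D_ge; nra.
Qed.

Let g_leD : par_g <= D.
Proof.
have h : 1 <= par_N%:R ^+ 3 :> R by rewrite exprn_ege1.
rewrite /par_g ler_pdivrMr ?mulr_gt0 ?exprn_gt0 // ler_peMr ?(ltW D_gt0) //; lra.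
Qed.

Let h_leg : par_h%:R * L <= par_g / (32 * 1024).
Proof.
have := ler_wpM2r (ltW L_gt0) h_le.
by rewrite gLE; have := gLL; lra.
Qed.

Let h_leD : par_h%:R <= D / 1024.
Proof.
have : par_h%:R <= par_h%:R * L by rewrite ler_peMr //; have := L_large; lra.
have := h_leg; have := g_leD; have := g_gt0; lra.
Qed.

Lemma par_Lam_large :
  D * (2 * par_h)%:R ^+ 2 * (2 / par_Lam) < (par_gam / 4) ^+ 2.
Proof.
have -> : (par_gam / 4) ^+ 2 = par_g / (16 * D).
  by rewrite -par_gam2; field; rewrite gt_eqF.
have -> : D * (2 * par_h)%:R ^+ 2 * (2 / par_Lam) = 8 * par_h%:R ^+ 2 / D ^+ 7.
  by rewrite natrM /par_Lam; field; rewrite gt_eqF.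
have h2 : par_h%:R ^+ 2 <= D ^+ 2.
  by rewrite lerXn2r ?nnegrE ?(ltW D_gt0) //; have := h_leD; have := D_gt0; lra.
have D7 : 0 < D ^+ 7 by rewrite exprn_gt0.
rewrite ltr_pdivrMr //.
have -> : par_g / (16 * D) * D ^+ 7 = par_g / 16 * (D ^+ 2 * D ^+ 4).
  by field; rewrite gt_eqF.
have g1 : 1 <= par_g by have := g_geL; have := L_large; lra.
have D4 : 1024 <= D ^+ 4.
  have -> : D ^+ 4 = D * D ^+ 3 by ring.
  have : 1 <= D ^+ 3 by rewrite exprn_ege1 //; have := D_ge; lra.
  by have := D_ge; nra.
have h3 : 8 * par_h%:R ^+ 2 <= 8 * D ^+ 2 by rewrite ler_wpM2l.
apply: le_lt_trans h3 _.
have h4 : 1024 <= par_g * D ^+ 4 by nra.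
nra.
Qed.

Let p : R := 1 / (2 * par_N%:R * T%:R).

Let T_gt0R : 0 < T%:R :> R. Proof. by rewrite ltr0n. Qed.

Let four_le : 4 <= expR L.
Proof. by have := D_ge; rewrite DE; lra. Qed.

Let p_ge : expR (- (3 * L)) <= p.
Proof.
rewrite /p expRN -[leRHS]/(1 / _) mul1r lef_pV2 ?posrE ?mulr_gt0 ?expR_gt0 //.
have h : par_N%:R * T%:R <= expR (L / 2) * expR (2 * L) by apply: ler_pM.
rewrite -expRD in h.
have -> : expR (3 * L) = expR (L / 2 + 2 * L) * expR (L / 2) by rewrite -expRD; congr expR; field.
have h2 : 2 <= expR (L / 2) by have := expR_ge1Dx (L / 2); have := L_large; lra.
have := expR_ge0 (L / 2 + 2 * L); rewrite -mulrA; nra.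
Qed.

Let pow78 (k : nat) : expR (- (k%:R / 7)) <= (7 / 8) ^+ k :> R.
Proof.
have -> : expR (- (k%:R / 7)) = expR (- (1 / 7)) ^+ k :> R.
  by rewrite -expRM_natr; congr expR; field.
rewrite lerXn2r ?nnegrE ?expR_ge0 // expRN invf_ple ?posrE ?expR_gt0 //.
by apply: le_trans (expR_ge1Dx _); lra.
Qed.

Let p0_ge : expR (- (3 * L) - par_u%:R / 7) <= p * (7 / 8) ^+ par_u.
Proof. by rewrite expRD; apply: ler_pM; rewrite ?expR_ge0. Qed.

Lemma par_spread : 4 * ((4 * (2 * par_h) + 2)%:R ^+ (2 * par_h) *
    expR (- (par_gam ^+ 2 * D / 2048))) <= p * (7 / 8) ^+ par_u.
Proof.
apply: le_trans p0_ge; rewrite par_gam2.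
have h1 : (4 * (2 * par_h) + 2)%:R ^+ (2 * par_h) <= expR (par_g / (8 * 1024)).
  apply: (@le_trans _ _ (expR (2 * L) ^+ (2 * par_h))).
    rewrite lerXn2r ?nnegrE ?expR_ge0 // D2_le // natrM.
    by have := h_leD; have := D_gt0; lra.
  by rewrite -expRM_natr ler_expR natrM; have := h_leg; lra.
apply: (@le_trans _ _ (expR L * (expR (par_g / (8 * 1024)) * expR (- (par_g / 2048))))).
  apply: ler_pM; rewrite ?mulr_ge0 ?exprn_ge0 ?expR_ge0 ?ler0n ?four_le //.
  by rewrite ler_wpM2r ?expR_ge0.
clear h1; rewrite -!expRD ler_expR; have := u_le; have := g_geL; have := L_gt0; lra.
Qed.

(** The slack [2 * r] in the exponent is spent twice: one [r] in [par_x], the other to absorb the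
    logarithm and the constants. *)
Lemma par_T : (T <= par_N.-1 * par_m.+1)%N.
Proof.
rewrite -(@ler_nat R) natrM -subn1 natrB ?(ltnW par_N_gt1) //.
apply: le_trans T_le _.
have hm : D / L / (32 * 1024) <= par_m.+1%:R by have := m_ge; have := n_ge; lra.
have hN : par_x / 2 <= par_N%:R - 1 by have := N_ge; lra.
have x0 : 0 <= par_x by exact: expR_ge0.
have DL0 : 0 <= D / L by have := DL_ge; lra.
apply: (@le_trans _ _ (par_x / 2 * (D / L / (32 * 1024)))); last first.
  have k0 : 0 <= D / L / (32 * 1024) by apply: divr_ge0; [exact: DL0 | rewrite mulr_ge0 ?ler0n].
  by apply: ler_pM; rewrite ?hN ?hm ?k0 ?divr_ge0 ?x0 ?ler0n.
have -> : par_x / 2 * (D / L / (32 * 1024)) = par_x * D / (64 * 1024 * L).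
  by field; rewrite gt_eqF // L_gt0.
rewrite ler_pdivlMr ?mulr_gt0 ?ltr0n ?L_gt0 //.
have -> : par_x * D = expR ((1 + dl / 6) * L - 2 * r) * E.
  by rewrite /par_x DE /E -!expRD; congr expR; ring.
rewrite ler_wpM2l ?expR_ge0 //; have := E_large; have := L_gt0; lra.
Qed.

Variable S : nat.
Hypothesis S_lt : S%:R < expR ((2 - dl) * L).

(** The product is of order [par_g ^+ 2 / L]; the spare factor [E ^+ 6] beats [L] and the
    constants. *)
Let hu_ge : expR ((2 - dl) * L) <= par_h%:R * par_u%:R / 8.
Proof.
have g2 : expR ((2 - dl) * L) * E ^+ 6 / 256 <= par_g ^+ 2.
  have -> : expR ((2 - dl) * L) * E ^+ 6 / 256 = (expR ((1 - dl / 2) * L) * E ^+ 3 / 16) ^+ 2.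
    have -> : expR ((2 - dl) * L) = expR ((1 - dl / 2) * L) ^+ 2.
      by rewrite -expRM_natr; congr expR; field.
    by field.
  have h0 : 0 <= expR ((1 - dl / 2) * L) * E ^+ 3 / 16.
    by rewrite divr_ge0 // mulr_ge0 ?exprn_ge0 ?expR_ge0.
  by rewrite lerXn2r ?nnegrE ?(ltW g_gt0).
have hu : par_g / L / (64 * 1024) * (par_g / (4 * 1024)) <= par_h%:R * par_u%:R.
  have k0 := le_trans (mulr_ge0 (ler0n R 1024) (ler0n R 1024)) gL_ge.
  have k1 : 0 <= par_g / L / (64 * 1024) by apply: divr_ge0; [exact: k0 | rewrite mulr_ge0 ?ler0n].
  have k2 : 0 <= par_g / (4 * 1024) by apply: divr_ge0; [exact: ltW g_gt0 | rewrite mulr_ge0 ?ler0n].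
  by apply: ler_pM; rewrite ?h_ge ?u_ge ?k1 ?k2.
have e : par_g / L / (64 * 1024) * (par_g / (4 * 1024)) = par_g ^+ 2 / (256 * 1024 * 1024 * L).
  by field; rewrite gt_eqF // L_gt0.
rewrite e in hu.
have E6 : 512 * 1024 * 1024 * 1024 * L <= E ^+ 6.
  have h2 : 1024 * 1024 * (1024 * 1024) * L <= E ^+ 2.
    rewrite expr2.
    apply: (@le_trans _ _ (1024 * 1024 * (1024 * 1024 * L))); first by rewrite [leRHS]mulrA lexx.
    by apply: ler_pM; rewrite ?mulr_ge0 ?ler0n ?(ltW L_gt0) ?E_ge ?E_large.
  have E1 : 1 <= E by have := E_ge; lra.
  have h6 : E ^+ 2 <= E ^+ 6 by rewrite ler_weXn2l.
  have := L_gt0; lra.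
rewrite ler_pdivlMr //; apply: le_trans hu.
rewrite ler_pdivlMr ?mulr_gt0 ?ltr0n ?L_gt0 //; apply: le_trans g2.
have := ler_wpM2l (expR_ge0 ((2 - dl) * L)) E6; lra.
Qed.

(** In logarithms the left side is at least hu/2 - 2hu/7 up to terms small against hu, because u >=
    256 L and h >= 100. The right side is below hu/8 + 2hL, and 1/2 - 2/7 exceeds 1/8 with enough
    room. *)
Lemma par_contradiction :
  p * (7 / 8) ^+ par_u / 2 * (p * (7 / 8) ^+ par_u / 4) ^+ (2 * par_h) *
    2 ^+ (par_h * par_u) <= 2 ^+ S * par_m.+1%:R ^+ (2 * par_h) -> False.
Proof.
have := p0_ge; move: (p * _ ^+ par_u) => q q_ge.
have [a aE] : exists a, a = - (4 * L) - par_u%:R / 7 by eexists.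
have e4 : expR a = expR (- (3 * L) - par_u%:R / 7) / expR L.
  by rewrite -expRN -expRD; congr expR; rewrite aE; ring.
have q4 : expR a <= q / 4.
  rewrite e4; apply: ler_pM; rewrite ?expR_ge0 ?invr_ge0 ?expR_ge0 //.
  by rewrite lef_pV2 ?posrE ?expR_gt0.
have q2 : expR a <= q / 2.
  by apply: le_trans q4 _; have := le_trans (expR_ge0 _) q_ge; lra.
have e2 : expR (1 / 2) <= 2 :> R.
  have := expR_ge1Dx (- (1 / 2) : R); rewrite expRN => h.
  by rewrite -(@lef_pV2 R) ?posrE ?expR_gt0 //; lra.
have e1 : 2 <= expR 1 :> R by have := expR_ge1Dx (1 : R); lra.
have mL : par_m.+1%:R <= expR L.
  rewrite -DE -natr1; have := m_le; have := n_leD; have := D_ge; lra.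
have lower : expR (a + a * (2 * par_h)%:R + (par_h * par_u)%:R / 2) <=
    q / 2 * (q / 4) ^+ (2 * par_h) *
      2 ^+ (par_h * par_u).
  rewrite !expRD; apply: ler_pM; rewrite ?mulr_ge0 ?expR_ge0 //.
    apply: ler_pM; rewrite ?expR_ge0 // expRM_natr lerXn2r ?nnegrE ?expR_ge0 //.
    exact: le_trans (expR_ge0 _) q4.
  have -> : (par_h * par_u)%:R / 2 = 1 / 2 * (par_h * par_u)%:R :> R by field.
  by rewrite expRM_natr lerXn2r ?nnegrE ?expR_ge0.
have upper : 2 ^+ S * par_m.+1%:R ^+ (2 * par_h) <= expR (S%:R + L * (2 * par_h)%:R).
  rewrite expRD; apply: ler_pM; rewrite ?exprn_ge0 //.
    by rewrite -[S%:R]mul1r expRM_natr lerXn2r ?nnegrE ?expR_ge0.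
  by rewrite expRM_natr lerXn2r ?nnegrE ?expR_ge0.
move=> H; have := le_trans lower (le_trans H upper); rewrite ler_expR !natrM aE; clear lower upper H q4 q2.
have hge : 100 <= par_h%:R :> R by rewrite ler_nat par_h_ge.
have uL : 256 * L <= par_u%:R by have := u_ge; have := g_geL; lra.
have hS := lt_le_trans S_lt hu_ge.
set h := par_h%:R in hge hS *; set u := par_u%:R in uL hS *.
have l0 := L_gt0.
nra.
Qed.

End ParameterChoice.

(** * The vanishing exponent and the Lipschitz normalization *)

Section SlackAndScale.
Variable R : realType.

Lemma cvg_sqrt_ln : Num.sqrt (ln (n%:R : R)) @[n --> \oo] --> +oo.
Proof.
apply/cvgryPge => B; near=> n.
have n0 : 0 < n%:R :> R by rewrite ltr0n; near: n; exists 1%N.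
have h : expR (B ^+ 2) <= n%:R.
  apply: (@le_trans _ _ (Num.truncn (expR (B ^+ 2))).+1%:R).
    by rewrite ltW // truncnS_gt.
  by rewrite ler_nat; near: n; exists (Num.truncn (expR (B ^+ 2))).+1.
apply: (le_trans (ler_norm B)); rewrite -sqrtr_sqr ler_wsqrtr //.
by rewrite -[leLHS]expRK ler_ln ?posrE ?expR_gt0.
Unshelve. all: by end_near. Qed.

Lemma cvg_slack : 2 / Num.sqrt (ln (n%:R : R)) @[n --> \oo] --> (0 : R).
Proof.
rewrite -[0 : R](mulr0 (2 : R)); apply: cvgMl_tmp.
apply/gtr0_cvgV0; last exact: cvg_sqrt_ln.
by move/cvgryPgt : cvg_sqrt_ln; apply.
Qed.

(** The walls have slope [Lam] times sqrt d and the hidden pieces slope 1, so the scale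
    [1 / (Lam * d)] suffices. *)
Lemma obj_lipschitz (d n N : nat) (Lam gam : R) (N_gt1 : (1 < N)%N) A V :
  (0 < d)%N -> 1 <= Lam ->
  lipschitz1_ball (@objF R d n N Lam gam (1 / (Lam * d%:R)) N_gt1 A V).
Proof.
move=> d_gt0 Lam1.
have Lam0 : 0 < Lam by lra.
have d1 : 1 <= d%:R :> R by rewrite ler1n.
have d0 : 0 < d%:R :> R by lra.
have sd0 : 0 < Num.sqrt (d%:R : R) by rewrite sqrtr_gt0.
have sd2 : Num.sqrt d%:R ^+ 2 = d%:R :> R by rewrite sqr_sqrtr ?ler0n.
apply: pwl_lipschitz; first by rewrite divr_ge0 ?mulr_ge0 // ltW.
  by exists (piece0 n (ltnW N_gt1)).
case=> [[j e]|i] _; rewrite /= normvZ normv_vec.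
  rewrite normrM normrX normrN1 expr1n mulr1 gtr0_norm //.
  have -> : 1 / (Lam * d%:R) * (Lam * Num.sqrt d%:R) = (Num.sqrt d%:R)^-1.
    by rewrite -{1}sd2; field; rewrite !gt_eqF.
  rewrite invf_le1 //; have : Num.sqrt 1 <= Num.sqrt (d%:R : R) by rewrite ler_wsqrtr.
  by rewrite sqrtr1.
rewrite gtr0_norm ?invr_gt0 // mulVf ?gt_eqF // mulr1.
by rewrite ler_pdivrMr ?mulr_gt0 // mul1r; nra.
Qed.

End SlackAndScale.

Theorem theorem1 (R : realType) (delta : R) :
  0 < delta -> delta < 1 ->
  exists (c : R) (eta : nat -> R) (d0 : nat),
    0 < c /\ eta n @[n --> \oo] --> (0 : R) /\
    forall (d S T : nat), (d0 <= d)%N ->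
    forall (dO : measure_display) (Omega : measurableType dO)
           (P : probability Omega R) (A : Omega -> det_alg R d S),
      (forall (F : 'rV[R]_d -> R) (g : 'rV[R]_d -> 'rV[R]_d),
         lipschitz1_ball F -> convex_ball F -> is_subgradient_oracle F g ->
         exists B : set Omega, measurable B /\
           B `<=` [set w | eps_optimal F (expR (- (ln (d%:R : R)) ^+ 5))
                             (alg_out T (A w) F g)] /\
           ((2 / 3 : R)%:E <= P B)%E) ->
      c * (d%:R `^ (2 - delta)) <= S%:R \/
      c * (d%:R `^ (1 + delta / 6 - eta d)) <= T%:R.
Proof.
move=> dl0 dl1; set M : R := 27 * 1024 * 1024.
have M2 : 2 <= M by rewrite /M; lra.
have [d0 _ hd0] := (cvgryPge _).1 (@cvg_sqrt_ln R) (Num.max (12 / delta) M).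
(* This [eta] turns d^(- eta) into expR (- 2 r); [d0] puts [r] above both thresholds. *)
exists 1, (fun n => 2 / Num.sqrt (ln n%:R)), d0.+1; split=> //; split; first exact: cvg_slack.
move=> d S T d0d dO Omega P alg halg.
have d_gt0 : (0 < d)%N by exact: leq_ltn_trans d0d.
have dR0 : 0 < d%:R :> R by rewrite ltr0n.
set L : R := ln d%:R in halg *.
have := hd0 d (ltnW d0d); rewrite /= -/L; set r := Num.sqrt L => rmax.
have r_dl : 12 / delta <= r by apply: le_trans rmax; rewrite le_max lexx.
have r_large : M <= r by apply: le_trans rmax; rewrite le_max lexx orbT.
have r_gt0 : 0 < r by lra.
have r2 : r ^+ 2 = L.
  by rewrite sqr_sqrtr //; apply/ltW; rewrite -sqrtr_gt0.
rewrite !mul1r /powR !(gt_eqF dR0) -/L.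
have -> : (1 + delta / 6 - 2 / r) * L = (1 + delta / 6) * L - 2 * r.
  by rewrite -r2; field; rewrite gt_eqF.
case: (lerP (expR ((2 - delta) * L)) S%:R) => [|S_lt]; first by left.
right; rewrite leNgt; apply/negP => T_lt.
(* The output depends on [T] only through [T.-1], so [T = 0] is treated as [T = 1]. *)
have T'_le : T.-1.+1%:R <= expR ((1 + delta / 6) * L - 2 * r).
  case: T halg T_lt => [_ _|T _ T_lt]; last exact: ltW.
  have h : 0 <= (1 + delta / 6) * L - 2 * r.
    have -> : (1 + delta / 6) * L - 2 * r = r * (r - 2) + delta / 6 * r ^+ 2.
      by rewrite -r2; field.
    by rewrite addr_ge0 // mulr_ge0 ?sqr_ge0 //; lra.
  by apply: le_trans (expR_ge1Dx _); rewrite lerDl.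
have N_gt1 := par_N_gt1 dl0 r_dl r_large r2.
have n_gt0 := par_n_gt0 d_gt0 r_large r2.
have h_gt0 : (0 < par_h delta r d)%N.
  exact: leq_trans (par_h_ge d_gt0 dl0 dl1 r_dl r_large r2).
have Lam_gt0 := par_Lam_gt0 R d_gt0.
have Lam1 : 1 <= par_Lam R d by rewrite /par_Lam exprn_ege1 // ler1n.
set Lam := par_Lam R d in Lam_gt0 Lam1.
set gam := par_gam delta r d.
set s : R := 1 / (Lam * d%:R).
have s_gt0 : 0 < s by rewrite divr_gt0 ?mulr_gt0.
pose F := @objF R d (par_n R d) _ Lam gam s N_gt1.
pose G := @objG R d (par_n R d) _ Lam gam s N_gt1.
pose Z := ({ffun 'I_(par_n R d) -> signs d} * {ffun 'I_(par_N delta r d) -> signs d})%type.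
have Z_gt0 : (0 < #|{: Z}|)%N.
  by apply/card_gt0P; exists ([ffun=> [ffun=> true]], [ffun=> [ffun=> true]]).
have ex_piece : exists z : 'I_(par_n R d) * bool + 'I_(par_N delta r d), xpredT z.
  by exists (piece0 _ (ltnW N_gt1)).
(* The averaging step needs a constant below 2/3; 3/5 still exceeds 1/2 by more than the two losses
   of 1/100. *)
have q_lt : 3 / 5 < 2 / 3 :> R by lra.
have [w] := ex_frequent_outcome q_lt Z_gt0 (fun z : Z =>
  halg (F z.1 z.2) (G z.1 z.2) (obj_lipschitz _ _ _ _ d_gt0 Lam1)
    (pwl_convex _ (ltW s_gt0) _ _ ex_piece) (pwl_subgradient _ (ltW s_gt0) _ _ ex_piece)).
rewrite card_prod natrM => hw.
have := @success_bound R d _ _ S T.-1.+1 Lam gam s (alg w) d_gt0 n_gt0 N_gt1 Lam_gt0 s_gt0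
  erefl _ (par_eps d_gt0 dl0 dl1 r_dl r_large r2) _ _ (par_h delta r d) _ erefl
  h_gt0
  (par_n_large d_gt0 dl0 r_dl r_large r2) (par_Lam_large d_gt0 dl0 dl1 r_dl r_large r2)
  (par_T d_gt0 dl0 r_dl r_large r2 T'_le) (par_noisy d_gt0 dl0 dl1 r_dl r_large r2 T'_le)
  (par_unsolvable d_gt0 dl0 dl1 r_dl r_large r2) hw
  (par_spread d_gt0 dl0 dl1 r_dl r_large r2 (ltn0Sn _) T'_le).
exact: (par_contradiction d_gt0 dl0 dl1 r_dl r_large r2 (ltn0Sn T.-1) T'_le S_lt).
Qed.
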